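(* Let $\mathcal{P}$ be the verbose persistence diagram of the infinite random lower triangular matrix $L$ over $\mathbb{F}_q$. Let \[X=\sum_{i=1}^{G-1} Y_i,\] where $G$ is a shifted geometric random variable with success probability $\frac{q-1}{q}$, $Y_i$ is a shifted geometric random variable with success probability $q^{-i}$ for each $i\in\mathbb{Z}_+$, and $G,Y_1,Y_2,Y_3,\dots$ are all independent. Then for almost all choices of $L$, we have that for all $k\in\mathbb{Z}_{\ge 0}$, \[\lim_{n\to\infty}\frac{|\{(b,d)\in\mathcal{P}\cap[1,n]^2 : d-b=k\}|}{n}=\mathbb{P}(X=k).\]
   Context: A $\mathbb{Z}_+$-valued random variable $Z$ is shifted geometric with success probability $p$ if $\mathbb{P}(Z=k)=p(1-p)^{k-1}$ for all $k\in\mathbb{Z}_+=\{1,2,\dots\}$. Setting. Fix a prime power $q$. Let $(L(i,j))_{1\le j\le i}$ ($i,j\in\mathbb{Z}_+$) be i.i.d. uniform random elements of $\mathbb{F}_q$, and let $L(i,j)=0$ for $1\le i<j$; $L=(L(i,j))_{i,j\in\mathbb{Z}_+}$. Let $\mathbb{F}_q^{\mathbb{Z}_+}$ denote the space of row vectors indexed by $\mathbb{Z}_+$ with only finitely many nonzero components. Let $Z_n=\{v\in\mathbb{F}_q^{\mathbb{Z}_+} : v_i=0\text{ for all }i>n\}$ and let $B_n=\{vL : v\in Z_n\}$ be the span of the first $n$ rows of $L$. For nonzero $v\in\mathbb{F}_q^{\mathbb{Z}_+}$ let $b(v)=\min\{i : v\in Z_i\}$ and $d(v)=\min\{i: v\in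 B_i\}$. Verbose persistence diagram. Let $\overline{\Delta}_{\mathbb{Z}}=\{(b,d)\in\mathbb{Z}_+^2 : b\le d\}$. With probability $1$ there is a unique subset $\mathcal{P}\subset\overline{\Delta}_{\mathbb{Z}}$ for which there is a basis $(v_p)_{p\in\mathcal{P}}$ of $\mathbb{F}_q^{\mathbb{Z}_+}$ such that $b(v_p)=b$, $d(v_p)=d$ for every $p=(b,d)\in\mathcal{P}$; for all $r,s\in\mathbb{Z}_+$ the vectors $\{v_p : p\in\mathcal{P}\cap([1,r]\times[1,s])\}$ form a basis of $Z_r\cap B_s$; and for all $r$ the vectors $\{v_p : p\in\mathcal{P}\cap([1,r]\times[1,\infty))\}$ form a basis of $Z_r$. This $\mathcal{P}$ is the verbose persistence diagram; it is characterized by $\dim (Z_r\cap B_s)=|\mathcal{P}\cap([1,r]\times[1,s])|$ for all $r,s\in\mathbb{Z}_+$. *)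

(* Defs.v *)
From mathcomp Require Import all_boot all_order all_algebra finmap.
From mathcomp Require Import all_classical all_reals all_analysis.
Import Order.TTheory GRing.Theory Num.Theory numFieldNormedType.Exports.

Set Implicit Arguments.
Unset Strict Implicit.
Unset Printing Implicit Defensive.

Local Open Scope classical_set_scope.
Local Open Scope ring_scope.

(** Random elements of a countable set [E] with its discrete sigma-algebra. *)

Definition discrete_rv (d : measure_display) (T : measurableType d) (E : Type)
    (X : T -> E) : Prop :=
  forall A : set E, measurable (X @^-1` A).

Definition mutually_independent (d : measure_display) (T : measurableType d)
    (R : realType) (P : probability T R) (E : Type) (I : choiceType)
    (J : set I) (X : I -> T -> E) : Prop :=
  forall (S : {fset I}) (A : I -> set E), [set` S] `<=` J ->
    P (\bigcap_(i in [set` S]) (X i @^-1` A i)) =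
    (\prod_(i <- S) P (X i @^-1` A i))%E.

Definition uniform_rv (d : measure_display) (T : measurableType d)
    (R : realType) (P : probability T R) (E : finType) (X : T -> E) : Prop :=
  discrete_rv X /\ forall a : E, P (X @^-1` [set a]) = ((#|E|%:R)^-1)%:E.

Definition shifted_geometric (d : measure_display) (T : measurableType d)
    (R : realType) (P : probability T R) (p : R) (Z : T -> nat) : Prop :=
  [/\ discrete_rv Z,
      forall w, (1 <= Z w)%N &
      forall k : nat, (1 <= k)%N ->
        P (Z @^-1` [set k]) = (p * (1 - p) ^+ (k - 1))%:E].

(** [(v i)_(i in D)] is a basis of the subspace [U] (possibly of infinite
    dimension): it is linearly independent and its span is [U]. *)
Definition is_basis (K : fieldType) (V : lmodType K) (I : choiceType)
    (D : set I) (v : I -> V) (U : set V) : Prop :=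
  (forall (S : {fset I}) (c : I -> K), [set` S] `<=` D ->
     \sum_(i <- S) c i *: v i = 0 -> forall i, i \in S -> c i = 0) /\
  U = [set u | exists (S : {fset I}) (c : I -> K),
         [set` S] `<=` D /\ u = \sum_(i <- S) c i *: v i].

(** Finitely supported row vectors are represented by their coefficient
    sequences, as elements of the [F]-vector space [{poly F}].  Coordinates, and
    rows and columns of matrices, are numbered from 0 (coordinate [i] here is
    coordinate [i + 1] in the 1-based convention), while the filtrations below
    and the points of the diagram keep the 1-based numbering. *)

Definition Zfilt (F : fieldType) (n : nat) : set {poly F} :=
  [set v | forall i : nat, (n <= i)%N -> v`_i = 0].

Definition row_mul (F : fieldType) (v : {poly F}) (M : nat -> nat -> F)
    (j : nat) : F :=
  \sum_(i < size v) v`_i * M i j.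

Definition Bfilt (F : fieldType) (M : nat -> nat -> F) (n : nat) :
    set {poly F} :=
  [set u | exists2 v, Zfilt n v & forall j : nat, u`_j = row_mul v M j].

Definition is_least (A : set nat) (m : nat) : Prop :=
  A m /\ forall i, A i -> (m <= i)%N.

Definition is_birth (F : fieldType) (v : {poly F}) (b : nat) : Prop :=
  is_least [set i | (1 <= i)%N /\ Zfilt i v] b.

(** A relation rather than a function, since [v] need not belong to any of the
    [Bfilt M i]. *)
Definition is_death (F : fieldType) (M : nat -> nat -> F) (v : {poly F})
    (d : nat) : Prop :=
  is_least [set i | (1 <= i)%N /\ Bfilt M i v] d.

Definition is_verbose_diagram (F : fieldType) (M : nat -> nat -> F)
    (D : set (nat * nat)) : Prop :=
  D `<=` [set p | (1 <= p.1 <= p.2)%N] /\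
  exists v : nat * nat -> {poly F},
    [/\ is_basis D v setT,
        forall p, D p -> is_birth (v p) p.1 /\ is_death M (v p) p.2,
        forall r s : nat, (1 <= r)%N -> (1 <= s)%N ->
          is_basis (D `&` `[1%N, r] `*` `[1%N, s]) v (Zfilt r `&` Bfilt M s) &
        forall r : nat, (1 <= r)%N ->
          is_basis (D `&` `[1%N, r] `*` `[1%N, +oo[) v (@Zfilt F r)].

(* Main.v *)
(* The class born at time b dies at time b + k exactly when the first basis
   row vector enters the row space of the diagonal block of L on the indices
   b, ..., b + k at its last row; by triangularity nothing outside that block
   matters. Adding a uniform row to a block in which the first class is alive
   and j classes are alive keeps j with probability 1 - q^-j, raises it to j +
   1 with probability q^-(j+1), and kills the first class with the remaining
   probability q^-j - q^-(j+1). The probability of being alive at age t with j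
   classes alive therefore satisfies the recursion of the law of Y 1 + ... + Y
   j, and the age at death has the law of X. For fixed k these events have the
   same probability for all b and are independent when the blocks are
   disjoint, so their frequencies converge by a second moment argument along
   the squares. Since X is finite, almost surely every class dies, and then
   the points (birth, death) form the unique verbose diagram. *)

Require Import Defs.
From mathcomp Require Import all_boot all_order all_algebra finmap.
From mathcomp Require Import mxabelem.
From mathcomp Require Import all_classical all_reals all_analysis.
From mathcomp Require Import measurable_realfun zify ring lra.
Import Order.TTheory GRing.Theory Num.Theory numFieldNormedType.Exports.

Set Implicit Arguments.
Unset Strict Implicit.

Local Open Scope classical_set_scope.
Local Open Scope ring_scope.

(** * Verbose diagrams of lower triangular matrices *)

Section VerboseDiagram.
Context {F : fieldType}.
Implicit Types (M : nat -> nat -> F) (u v w : {poly F}).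

Lemma ZfiltE n v : Zfilt n v <-> (size v <= n)%N.
Proof. by split => [h|/leq_sizeP//]; apply/leq_sizeP. Qed.

Lemma size_subZ_lt u v : v != 0 -> size v = size u ->
  (size (u - (lead_coef u / lead_coef v) *: v)%R < size u)%N.
Proof.
move=> v0 suv; have lv : lead_coef v != 0 by rewrite lead_coef_eq0.
have u0 : (0 < size u)%N by rewrite -suv size_poly_gt0.
rewrite -[X in (_ < X)%N](prednK u0) ltnS; apply/leq_sizeP => j.
rewrite leq_eqVlt => /predU1P[<-|hj]; rewrite coefB coefZ.
  by rewrite -{2}suv -!/(lead_coef _) divfK// subrr.
rewrite prednK// in hj.
by rewrite nth_default// (nth_default _ (_ : size v <= j)%N) ?suv// mulr0 subrr.
Qed.

(** The sum defining [row_mul] stops at the size of the vector, and sizes are not additive; all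
    three sums are therefore padded with zero terms up to a common bound. *)
Lemma row_mulDZ M a u w j :
  Defs.row_mul (u + a *: w) M j = Defs.row_mul u M j + a * Defs.row_mul w M j.
Proof.
have ext (v : {poly F}) n : (size v <= n)%N ->
    Defs.row_mul v M j = \sum_(i < n) v`_i * M i j.
  move=> h; rewrite /Defs.row_mul (big_ord_widen n (fun i => v`_i * M i j) h).
  rewrite big_mkcond; apply: eq_bigr => i _; case: ltnP => // hi.
  by rewrite nth_default ?mul0r.
pose n := maxn (size (u + a *: w)) (maxn (size u) (size w)).
rewrite !(ext _ n) ?leq_max ?leqnn ?orbT// mulr_sumr -big_split/=.
by apply: eq_bigr => i _; rewrite coefD coefZ mulrDl mulrA.
Qed.

Lemma Bfilt0 M n : Bfilt M n 0.
Proof.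
exists 0 => [i _|j]; first by rewrite coef0.
by rewrite coef0 /Defs.row_mul size_poly0 big_ord0.
Qed.

Lemma BfiltDZ M n a u w : Bfilt M n u -> Bfilt M n w -> Bfilt M n (u + a *: w).
Proof.
move=> [u' zu hu] [w' zw hw]; exists (u' + a *: w').
  by move=> i hi; rewrite coefD coefZ zu// zw// mulr0 addr0.
by move=> j; rewrite coefD coefZ row_mulDZ hu hw.
Qed.

Lemma le_Bfilt M m n u : (m <= n)%N -> Bfilt M m u -> Bfilt M n u.
Proof.
move=> mn [v zv hv]; exists v => // i ni; apply: zv; exact: leq_trans ni.
Qed.

Lemma Bfilt_Zfilt M n u : (forall i j, (i < j)%N -> M i j = 0) ->
  Bfilt M n u -> Zfilt n u.
Proof.
move=> trig [v /ZfiltE sv hv] j nj; rewrite hv /Defs.row_mul big1// => i _.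
by rewrite trig ?mulr0//; apply: leq_trans (ltn_ord i) (leq_trans sv nj).
Qed.

Lemma Bfilt_0 M u : Bfilt M 0 u -> u = 0.
Proof.
move=> [v /ZfiltE]; rewrite leqn0 size_poly_eq0 => /eqP-> hu.
by apply/polyP => j; rewrite hu coef0 /Defs.row_mul size_poly0 big_ord0.
Qed.

(** * Bases made of vectors of distinct sizes *)

Section Echelon.
Context {I : choiceType} (D : set I) (v : I -> {poly F}) (U : set {poly F}).

Lemma span_add (S1 S2 : {fset I}) (c1 c2 : I -> F) :
  [set` S1] `<=` D -> [set` S2] `<=` D ->
  exists (S : {fset I}) (c : I -> F), [set` S] `<=` D /\
    \sum_(i <- S1) c1 i *: v i + \sum_(i <- S2) c2 i *: v i =
    \sum_(i <- S) c i *: v i.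
Proof.
move=> S1D S2D; exists (S1 `|` S2)%fset.
exists (fun i => (if i \in S1 then c1 i else 0) + (if i \in S2 then c2 i else 0)).
split=> [i /=|]; first by rewrite in_fsetU => /orP[/S1D|/S2D].
under [RHS]eq_bigr do rewrite scalerDl.
rewrite big_split/=; congr (_ + _).
  rewrite -(big_fset_incl _ (fsubsetUl S1 S2)) /=.
    by rewrite big_seq [RHS]big_seq; apply: eq_bigr => i ->.
  by move=> i _ /negPf ->; rewrite scale0r.
rewrite -(big_fset_incl _ (fsubsetUr S1 S2)) /=.
  by rewrite big_seq [RHS]big_seq; apply: eq_bigr => i ->.
by move=> i _ /negPf ->; rewrite scale0r.
Qed.

(** Independence: in a relation, the leading coefficient of the largest vector involved cannot
    cancel. Spanning: subtracting a multiple of the family member of the same size shortens a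
    vector, so induction on the size applies. Since size is birth time, every basis required of a
    verbose diagram has this form. *)
Lemma echelon_basis :
  (forall p, D p -> v p != 0) ->
  (forall p q, D p -> D q -> size (v p) = size (v q) -> p = q) ->
  (forall p, D p -> U (v p)) -> U 0 ->
  (forall a u w, U u -> U w -> U (u + a *: w)) ->
  (forall u, U u -> u != 0 -> exists2 p, D p & size (v p) = size u) ->
  is_basis D v U.
Proof.
move=> v0 vinj DU U0 UD Usurj; split.
  move=> S c SD sum0 i iS; apply/eqP/negPn/negP => ci.
  pose i0 : S := [` iS]%fset.
  case: (@arg_maxnP S i0 (fun j => c (val j) != 0) (fun j => size (v (val j)))).
    exact: ci.
  move=> m cm mmax; have mS : val m \in S := valP m.
  (* The relation is read at the leading position of [v (val m)], the largest vector with nonzero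
     coefficient, where all other terms vanish. *)
  have := congr1 (fun p : {poly F} => p`_(size (v (val m))).-1) sum0.
  rewrite coef0 coef_sum (bigD1_seq (val m)) ?fset_uniq//= big_seq_cond big1.
    rewrite addr0 coefZ -/(lead_coef _) => /eqP.
    by rewrite mulf_eq0 (negPf cm) lead_coef_eq0 (negPf (v0 _ (SD _ mS))).
  move=> j /andP[jS jm]; rewrite coefZ.
  have [->|cj] := eqVneq (c j) 0; first by rewrite mul0r.
  have := mmax [` jS]%fset cj; rewrite /= leq_eqVlt => /predU1P[e|lt].
    by rewrite (vinj j (val m)) ?eqxx// in jm; exact: SD.
  rewrite nth_default ?mulr0// -ltnS prednK//.
  exact: leq_ltn_trans lt.
apply/seteqP; split=> [u|_ [S [c [SD ->]]]]; last first.
  rewrite big_seq; apply: (big_ind U) => // [x y Ux Uy|i iS].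
    by rewrite -[y]scale1r; exact: UD.
  by rewrite -[_ *: _]add0r; apply: UD => //; apply/DU/SD.
have [n] := ubnP (size u); elim: n u => // n IH u; rewrite ltnS => sun Uu.
have [->|u0] := eqVneq u 0.
  by exists fset0, (fun=> 0); split=> //; rewrite big_seq_fset0.
have [p Dp sp] := Usurj u Uu u0.
set a := lead_coef u / lead_coef (v p).
have lt : (size (u - a *: v p)%R < size u)%N by exact: size_subZ_lt (v0 p Dp) sp.
case: (IH (u - a *: v p)) => [||S1 [c1 [S1D e1]]].
- exact: leq_trans lt sun.
- by rewrite -scaleNr; apply: UD => //; exact: DU.
have S2D : [set` [fset p]%fset] `<=` D by move=> i /=; rewrite inE => /eqP->.
have [S [c [SD e]]] := span_add c1 (fun=> a) S1D S2D.
by exists S, c; split=> //; rewrite -e -e1 big_seq_fset1 subrK.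
Qed.

End Echelon.

(* Some vector of [Bfilt M s] is born at time [b + 1], i.e. has its last nonzero
   coordinate at the 0-based position [b]; the least such [s] is the death time
   of the class born at time [b + 1]. *)
Definition reach M (b s : nat) : Prop :=
  exists v, [/\ Zfilt b.+1 v, v`_b != 0 & Bfilt M s v].

Definition diagram M : set (nat * nat) :=
  [set p | (1 <= p.1)%N /\ is_least (reach M p.1.-1) p.2].

Lemma reach0 M b : ~ reach M b 0.
Proof. by move=> [v [_ vb /Bfilt_0 v0]]; rewrite v0 coef0 eqxx in vb. Qed.

Lemma size_birth b v : Zfilt b.+1 v -> v`_b != 0 -> size v = b.+1.
Proof.
move=> /ZfiltE h vb; apply/eqP; rewrite eqn_leq h/= ltnNge; apply/negP => hs.
by rewrite nth_default ?eqxx in vb.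
Qed.

Lemma birth_size b v : is_birth v b -> v != 0 -> size v = b.
Proof.
move=> [[b1 /ZfiltE h] hl] v0; apply/eqP; rewrite eqn_leq h/=; apply: hl.
by split; [rewrite size_poly_gt0|apply/ZfiltE].
Qed.

Lemma size_is_birth b v : size v = b.+1 -> is_birth v b.+1.
Proof.
move=> sv; split=> [|i [_ /ZfiltE]]; last by rewrite sv.
by split => //; apply/ZfiltE; rewrite sv.
Qed.

(** Each point gets a vector whose size is the birth time and which lies in the [Bfilt] of the death
    time. Births are distinct, so all the bases come from [echelon_basis]. *)
Lemma diagram_verbose M : (forall i j, (i < j)%N -> M i j = 0) ->
  (forall b, exists s, reach M b s) -> is_verbose_diagram M (diagram M).
Proof.
move=> trig cov.
(* The zero vector is a placeholder off the diagram. *)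
have vex (p : nat * nat) : exists v, diagram M p ->
    [/\ size v = p.1 & Bfilt M p.2 v].
  have [[p1 [[v [zv vb hv]] _]]|ND] := pselect (diagram M p); last by exists 0.
  by exists v => _; split=> //; rewrite (size_birth zv vb) prednK.
have [v vP] := boolp.choice vex.
have v0 p : diagram M p -> v p != 0.
  by move=> Dp; rewrite -size_poly_gt0 (vP p Dp).1; case: Dp.
have Dfun p q : diagram M p -> diagram M q -> p.1 = q.1 -> p = q.
  case: p q => [b d] [b' d'] [/= b1 [rd ld]] [/= b1' [rd' ld']] e; subst b'.
  by congr pair; apply/eqP; rewrite eqn_leq ld// ld'.
have vinj p q : diagram M p -> diagram M q -> size (v p) = size (v q) -> p = q.
  by move=> Dp Dq; rewrite (vP p Dp).1 (vP q Dq).1; exact: Dfun.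
have least b : exists d, is_least (reach M b) d.
  have [s rs] := cov b.
  have ex : exists s, `[< reach M b s >] by exists s; apply/asboolP.
  exists (ex_minn ex); case: ex_minnP => m /asboolP rm lm.
  by split=> // i /asboolP; exact: lm.
have surj u : u != 0 -> exists2 p, diagram M p & p.1 = size u.
  move=> u0; have [d hd] := least (size u).-1.
  exists (size u, d) => //; split=> //=; by rewrite size_poly_gt0.
have p12 p : diagram M p -> (1 <= p.1 <= p.2)%N.
  move=> Dp; have [p1 _] := Dp; have [sv Bv] := vP p Dp.
  by have /ZfiltE := Bfilt_Zfilt trig Bv; rewrite sv /= => ->; rewrite p1.
split; first exact: p12.
exists v; split.
- apply: echelon_basis => // u _ /surj[p Dp <-]; exists p => //.
  by rewrite (vP p Dp).1.
- move=> p Dp; have [sv Bv] := vP p Dp; have [p1 [_ lp]] := Dp; split.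
    by rewrite -(prednK p1); apply: size_is_birth; rewrite sv prednK.
  split=> [|i [i1 Bi]].
    by split=> //; apply: leq_trans p1 _; have /andP[] := p12 p Dp.
  apply: lp; exists (v p); split=> //; last by rewrite -sv -lead_coefE lead_coef_eq0 v0.
  by apply/ZfiltE; rewrite sv prednK.
- move=> r s r1 s1; apply: echelon_basis.
  + by move=> p [/v0].
  + by move=> p q [Dp _] [Dq _]; exact: vinj.
  + move=> p [Dp]/= [/[!in_itv]/= /andP[_ pr] /andP[_ ps]].
    have [sv Bv] := vP p Dp; split; last exact: le_Bfilt Bv.
    by apply/ZfiltE; rewrite sv.
  + by split; [move=> i _; rewrite coef0|exact: Bfilt0].
  + move=> a u w [zu Bu] [zw Bw]; split; last exact: BfiltDZ.
    by move=> i hi; rewrite coefD coefZ zu// zw// mulr0 addr0.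
  + move=> u [/ZfiltE zu Bu] u0; have [p Dp e] := surj u u0.
    exists p; last by rewrite (vP p Dp).1.
    have /andP[p1 le12] := p12 p Dp; have [_ [_ lp]] := Dp.
    split=> //; split; rewrite /= in_itv/=; apply/andP; split=> //.
    - by rewrite e; exact: zu.
    - exact: leq_trans p1 le12.
    (* The vector [u] itself witnesses [reach] at [s], so the class with its birth time dies by
       [s]. *)
    apply: lp; exists u; split=> //; last by rewrite e -lead_coefE lead_coef_eq0.
    by apply/ZfiltE; rewrite e prednK// size_poly_gt0.
- move=> r r1; apply: echelon_basis.
  + by move=> p [/v0].
  + by move=> p q [Dp _] [Dq _]; exact: vinj.
  + move=> p [Dp]/= [/[!in_itv]/= /andP[_ pr] _].
    by apply/ZfiltE; rewrite (vP p Dp).1.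
  + by move=> i _; rewrite coef0.
  + move=> a u w zu zw i hi.
    by rewrite coefD coefZ zu// zw// mulr0 addr0.
  + move=> u /ZfiltE zu u0; have [p Dp e] := surj u u0.
    exists p; last by rewrite (vP p Dp).1.
    have /andP[p1 le12] := p12 p Dp.
    split=> //; split; rewrite /= in_itv/=; apply/andP; split=> //.
    - by rewrite e; exact: zu.
    - exact: leq_trans p1 le12.
Qed.

Lemma span_size {I : choiceType} (v : I -> {poly F}) (S : {fset I}) c u :
  u != 0 -> u = \sum_(i <- S) c i *: v i ->
  exists2 p, p \in S & (size u <= size (v p))%N.
Proof.
move=> u0 e; apply: contrapT => H.
have : lead_coef u = 0.
  rewrite lead_coefE {1}e coef_sum big_seq big1// => i iS.
  rewrite coefZ nth_default ?mulr0// -ltnS prednK ?size_poly_gt0//.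
  by rewrite ltnNge; apply/negP => h; apply: H; exists i.
by apply/eqP; rewrite lead_coef_eq0.
Qed.

(** No two points of [D] share a birth time ([inj]). A vector of [Bfilt M s] born at [b + 1] expands
    over points of [[1, b + 1] x [1, s]], and one of them must have birth [b + 1]; hence deaths in
    [D] are the least [s] satisfying [reach] ([key]). *)
Lemma verbose_diagram_unique M D : is_verbose_diagram M D -> D = diagram M.
Proof.
move=> [Dsub [v [[indep _] vbd bBas zBas]]].
have v0 p : D p -> v p != 0.
  move=> Dp; apply/eqP => vp0.
  have := indep [fset p]%fset (fun=> 1); rewrite big_seq_fset1 vp0 scaler0.
  have sub : [set` [fset p]%fset] `<=` D by move=> i /=; rewrite inE => /eqP->.
  move=> /(_ sub erefl p); rewrite inE eqxx => /(_ isT)/eqP.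
  by rewrite oner_eq0.
have sv p : D p -> size (v p) = p.1.
  by move=> Dp; apply: birth_size (v0 _ Dp); exact: (vbd p Dp).1.
have p1 p : D p -> (0 < p.1)%N by move=> /Dsub /= /andP[].
(* If two distinct points had the same birth, eliminating the leading term of [v q] by [v p] would
   leave a combination of vectors born earlier, contradicting independence. *)
have inj p q : D p -> D q -> p.1 = q.1 -> p = q.
  move=> Dp Dq epq; apply/eqP/negPn/negP => npq.
  pose a := lead_coef (v q) / lead_coef (v p).
  have lt : (size (v q - a *: v p)%R < q.1)%N.
    by rewrite -(sv q Dq); apply: size_subZ_lt; [exact: v0|rewrite !sv].
  have [S [c [SD [pS qS eS]]]] : exists (S : {fset nat * nat}) (c : nat * nat -> F),
      [set` S] `<=` D /\ [/\ p \notin S, q \notin S &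
      v q - a *: v p = \sum_(i <- S) c i *: v i].
    (* The zero difference is treated apart because the basis of [Zfilt r] is only given for [r] at
       least 1. *)
    have [w0|w0] := eqVneq (v q - a *: v p) 0.
      exists fset0, (fun=> 0); split=> //; rewrite !inE; split=> //.
      by rewrite w0 big_seq_fset0.
    have q2 : (1 <= q.1.-1)%N.
      by move: w0; rewrite -size_poly_gt0 => w0; rewrite -ltnS prednK ?p1//;
         exact: leq_ltn_trans w0 lt.
    have [_ /seteqP[hz _]] := zBas _ q2.
    have [|S [c [SD eS]]] := hz (v q - a *: v p).
      by apply/ZfiltE; rewrite -ltnS prednK ?p1.
    exists S, c; split; first by move=> i /SD[].
    have H i : i \in S -> (i.1 <= q.1.-1)%N.
      by move=> /SD[_ []] /=; rewrite in_itv/= => /andP[].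
    by split=> //; apply/negP => /H; rewrite ?epq leqNgt prednK ?p1// leqnn.
  pose c' i := if i == q then 1 else if i == p then - a else - c i.
  have sub : [set` (q |` (p |` S))%fset] `<=` D.
    by move=> i /=; rewrite !inE => /or3P[/eqP->|/eqP->|/SD].
  have := indep (q |` (p |` S))%fset c' sub.
  rewrite !big_fsetU1//= ?inE ?negb_or ?qS 1?eq_sym ?npq//.
  rewrite /c' eqxx (negPf npq) eqxx.
  rewrite (eq_big_seq (fun i => - (c i *: v i))); last first.
    move=> i iS /=; rewrite !ifF ?scaleNr//; apply/eqP => e; subst i.
      by rewrite iS in pS.
    by rewrite iS in qS.
  rewrite sumrN -eS scale1r scaleNr opprB [- _ + _]addrA addNr add0r subrr.
  move=> /(_ erefl q); rewrite !inE !eqxx => /(_ isT) /eqP.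
  by rewrite oner_eq0.
have key b s : reach M b s -> exists2 d, D (b.+1, d) & (d <= s)%N.
  move=> [u [zu ub Bu]].
  have s1 : (1 <= s)%N.
    by case: s Bu => // Bu; have /reach0 : reach M b 0 by exists u.
  have [_ /seteqP[hz _]] := bBas b.+1 s isT s1.
  have [|S [c [SD eS]]] := hz u; first by split.
  have u0 : u != 0 by apply: contra_neq ub => ->; rewrite coef0.
  have [[b' d] pS] := span_size u0 eS.
  have /= [Dp [/= /[!in_itv]/= /andP[_ br] /andP[_ ds]]] := SD _ pS.
  rewrite (size_birth zu ub) sv//= => bb.
  by exists d => //; have -> : b.+1 = b' by apply/eqP; rewrite eqn_leq bb.
have conv p : D p -> reach M p.1.-1 p.2.
  move=> Dp; exists (v p); split.
  - by apply/ZfiltE; rewrite prednK ?p1// sv.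
  - by rewrite -(sv p Dp) -lead_coefE lead_coef_eq0 v0.
  - by have [_ [[]]] := vbd p Dp.
apply/seteqP; split=> [[b d] Dp|[b d] [/= b1 [rd ld]]].
  split; first exact: p1 Dp.
  split=> [|s rs]; first exact: conv Dp.
  have [d' Dp' ds] := key _ _ rs.
  rewrite /= prednK in Dp'; last exact: (p1 _ Dp).
  by have [->] : (b, d) = (b, d') by exact: inj.
have [d' Dp' ds] := key _ _ rd; rewrite prednK// in Dp'.
suff <- : d' = d by [].
by apply/eqP; rewrite eqn_leq ds/=; apply: ld; exact: conv Dp'.
Qed.
End VerboseDiagram.

(** * Diagonal blocks *)

Section Blocks.
Context {F : fieldType}.
Implicit Types (M : nat -> nat -> F).

(* The last column vanishes when [M] is lower triangular; it is there so that
   the first basis row vector exists even when [t = 0]. *)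
Definition block M b t : 'M[F]_(t, t.+1) := \matrix_(i, j) M (b + i)%N (b + j)%N.

Definition block_row M b t : 'rV[F]_t.+1 := \row_j M (b + t)%N (b + j)%N.

Definition e0 {n : nat} : 'rV[F]_n.+1 := delta_mx 0 0.

Lemma row_mul_block M b t w j : (forall i j, (i < j)%N -> M i j = 0) ->
  Zfilt (b + t) w ->
  Defs.row_mul w M (b + j) = \sum_(i < t) w`_(b + i) * M (b + i)%N (b + j)%N.
Proof.
move=> trig /ZfiltE sw.
have -> : Defs.row_mul w M (b + j) = \sum_(i < b + t) w`_i * M i (b + j)%N.
  rewrite /Defs.row_mul (big_ord_widen _ (fun i => w`_i * M i (b + j)%N) sw).
  rewrite big_mkcond; apply: eq_bigr => i _; case: ltnP => // hi.
  by rewrite nth_default ?mul0r.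
rewrite big_split_ord/= big1 ?add0r// => i _.
by rewrite trig ?mulr0// ltn_addr.
Qed.

(* By triangularity a combination of the first [b + t] rows of [M] only involves
   rows [b, ..., b + t - 1] in the columns from [b] on. *)
Lemma reach_block M b t : (forall i j, (i < j)%N -> M i j = 0) ->
  reach M b (b + t) <-> (e0 <= block M b t)%MS.
Proof.
move=> trig; split.
  move=> [v [zv vb [w zw hw]]].
  (* The coefficients of [w] on the rows of the block, scaled to make coordinate [b] equal to 1. *)
  apply/submxP; exists (\row_(i < t) ((v`_b)^-1 * w`_(b + i))).
  apply/rowP => j; rewrite !mxE eqxx/=.
  under eq_bigr do rewrite !mxE -mulrA.
  rewrite -mulr_sumr -row_mul_block// -hw.
  have [j0|j0] := eqVneq j 0; first by rewrite j0 addn0 mulVf.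
  have bj : (b.+1 <= b + j)%N by rewrite -[b.+1]addn1 leq_add2l lt0n.
  by rewrite (zv _ bj) mulr0.
move=> /submxP[x ex].
pose w := rVpoly x * 'X^b.
have wE (i : 'I_t) : w`_(b + i) = x 0 i.
  by rewrite coefMXn ltnNge leq_addr/= addKn coef_rVpoly_ord.
have zw : Zfilt (b + t) w.
  move=> i hi; rewrite coefMXn; case: ltnP => // bi.
  rewrite nth_default//; apply: leq_trans (size_poly _ _) _.
  by rewrite leq_subRL.
have wM (j : 'I_t.+1) : Defs.row_mul w M (b + j) = (j == 0)%:R.
  rewrite (row_mul_block _ trig zw); have /rowP/(_ j) := ex; rewrite !mxE eqxx/= => ->.
  by apply: eq_bigr => i _; rewrite !mxE wE.
(* Truncation after column [b] loses nothing: the product vanishes on the later block columns by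
   [wM] and beyond the block by triangularity. *)
exists (\poly_(j < b.+1) Defs.row_mul w M j); split.
- by apply/ZfiltE; exact: size_poly.
- by rewrite coef_poly ltnSn -[b in X in X != _]addn0 (wM 0) oner_eq0.
- exists w => // j; rewrite coef_poly; case: ltnP => // bj.
  have [jt|jt] := ltnP (j - b) t.+1.
    have /= := wM (Ordinal jt); rewrite subnKC ?(ltnW bj)// => ->.
    by rewrite -val_eqE/= subn_eq0 leqNgt bj.
  have jE : j = (b + (j - b))%N by rewrite subnKC// ltnW.
  rewrite jE (row_mul_block _ trig zw) big1// => i _; rewrite trig ?mulr0//.
  by rewrite ltn_add2l; apply: leq_trans (ltn_ord i) (ltnW jt).
Qed.

Lemma reach_leq M b s s' : (s <= s')%N -> reach M b s -> reach M b s'.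
Proof. by move=> ss' [v [? ? ?]]; exists v; split=> //; exact: le_Bfilt ss' _. Qed.

Lemma reach_gt M b s : (forall i j, (i < j)%N -> M i j = 0) ->
  reach M b s -> (b < s)%N.
Proof.
move=> trig [v [_ vb /(Bfilt_Zfilt trig) zv]]; rewrite ltnNge; apply/negP => sb.
by rewrite zv ?eqxx in vb.
Qed.

(** As [reach] is monotone in the number of rows, minimality need only be tested one row earlier.
    Death at [b.+1 + k] means that the first [b + k.+1] rows suffice, hence a block of [k.+1]
    rows. *)
Lemma diagram_block M b k : (forall i j, (i < j)%N -> M i j = 0) ->
  diagram M (b.+1, (b.+1 + k)%N) <->
  ((e0 <= block M b k.+1)%MS && ~~ (e0 <= block M b k)%MS).
Proof.
move=> trig; rewrite addSnnS; split=> [[_ /= [rk lk]]|/andP[rk nrk]].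
  apply/andP; split; first exact/reach_block.
  apply/negP => /(reach_block _ _ trig)/lk; by rewrite leq_add2l ltnn.
split=> //; split; first by apply/reach_block.
move=> i /= ri; rewrite addnS ltnNge; apply: contra nrk => ik.
by apply/reach_block => //; exact: reach_leq ri.
Qed.

(** The larger block also gains a last column, zero by triangularity; [pid_mx] appends it. Being row
    free, [pid_mx] preserves ranks and inclusions of row spaces. *)
Lemma blockS_eqmx M b t : (forall i j, (i < j)%N -> M i j = 0) ->
  (block M b t.+1 :=: col_mx (block M b t) (block_row M b t) *m pid_mx t.+1)%MS.
Proof.
move=> trig.
have e : block M b t.+1 = castmx (addn1 t, erefl)
    (col_mx (block M b t) (block_row M b t) *m pid_mx t.+1).
  apply/matrixP => i j; rewrite castmxE/= cast_ord_id !mxE.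
  transitivity (\sum_(k < t.+1) M (b + i)%N (b + k)%N *
      (pid_mx t.+1 : 'M[F]_(t.+1, t.+2)) k j); last first.
    apply: eq_bigr => k _; congr (_ * _); rewrite mxE.
    case: splitP => i' /= ei; rewrite mxE ei//.
    by rewrite [i']ord1 addn0.
  case: (unliftP ord_max j) => [j' ->|->].
    rewrite lift_max (bigD1 j')//= mxE lift_max eqxx ltn_ord mulr1 big1 ?addr0// => k kj.
    by rewrite mxE lift_max val_eqE (negPf kj) mulr0.
  rewrite trig ?ltn_add2l//= big1// => k _.
  by rewrite mxE /= ltn_eqF ?mulr0.
by rewrite e; exact: eqmx_cast.
Qed.

Lemma e0_pid n : @e0 n *m pid_mx n.+1 = @e0 n.+1.
Proof.
unfold e0; rewrite -rowE; apply/rowP => j; rewrite !mxE !eqxx/= andbT.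
by rewrite [(0 == _ :> nat)%N]eq_sym.
Qed.

Lemma e0_blockS M b t : (forall i j, (i < j)%N -> M i j = 0) ->
  (e0 <= block M b t.+1)%MS =
  (e0 <= col_mx (block M b t) (block_row M b t))%MS.
Proof.
move=> trig; rewrite (blockS_eqmx b t trig) -e0_pid submxMfree//.
by rewrite /row_free rank_pid_mx.
Qed.

Lemma rank_blockS M b t : (forall i j, (i < j)%N -> M i j = 0) ->
  \rank (block M b t.+1) = \rank (col_mx (block M b t) (block_row M b t)).
Proof.
move=> trig; rewrite (blockS_eqmx b t trig) mxrankMfree//.
by rewrite /row_free rank_pid_mx.
Qed.

(** Steinitz exchange: as [e] is outside [B], its expression through [r] has a nonzero coefficient
    on [r] and can be solved for [r]. The condition on [r] becomes membership in fixed subspaces,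
    which can be counted. *)
Lemma exchange_submx m n (B : 'M[F]_(m, n)) (e r : 'rV[F]_n) :
  ~~ (e <= B)%MS ->
  (e <= col_mx B r)%MS = ~~ (r <= B)%MS && (r <= col_mx B e)%MS.
Proof.
move=> eB.
have half (x y : 'rV[F]_n) :
    ~~ (x <= B)%MS -> (x <= col_mx B y)%MS -> (y <= col_mx B x)%MS.
  move=> xB; rewrite -addsmxE => /sub_addsmxP[[u v] /= xE].
  have [v0|v0] := eqVneq (v 0 0) 0.
    case/negP: xB; rewrite xE (_ : v = 0); last first.
      by apply/rowP => i; rewrite ord1 v0 mxE.
    by rewrite mul0mx addr0 submxMl.
  move: xE; rewrite [v]mx11_scalar mul_scalar_mx => /esym/(canRL (addKr _)) yE.
  have -> : y = (v 0 0)^-1 *: (- (u *m B) + x) by rewrite -yE scalerA mulVf// scale1r.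
  rewrite scalemx_sub// -addsmxE addmx_sub_adds// -mulNmx submxMl//.
apply/idP/andP => [h|[rB h]].
  split; last exact: half h.
  apply: contra eB => rB; apply: submx_trans h _.
  by rewrite col_mx_sub submx_refl.
exact: half h.
Qed.

Lemma rank_col_mx m n (B : 'M[F]_(m, n)) (r : 'rV[F]_n) :
  \rank (col_mx B r) = (\rank B + ~~ (r <= B)%MS)%N.
Proof.
have [rB|rB] := boolP (r <= B)%MS; rewrite ?addn0.
  apply/eqP; rewrite eqn_leq !mxrankS//.
    by rewrite -addsmxE addsmxSl.
  by rewrite col_mx_sub submx_refl.
apply/eqP; rewrite eqn_leq -addsmxE; apply/andP; split.
  by apply: leq_trans (mxrank_adds_leqif B r).1 _; rewrite leq_add2l rank_leq_row.
rewrite addn1; apply: rank_ltmx; rewrite ltmxE addsmxSl/=; apply: contra rB.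
exact: submx_trans (addsmxSr _ _).
Qed.

End Blocks.

(** * Counting the effect of one more row *)

Section RowCounting.
Context {F : finFieldType}.

Lemma card_submx m n (B : 'M[F]_(m, n)) :
  #|[set r : 'rV[F]_n | (r <= B)%MS]%SET| = (#|F| ^ \rank B)%N.
Proof. by rewrite -card_rowg; apply: eq_card => r; rewrite !inE. Qed.

Lemma card_rV n : #|'rV[F]_n| = (#|F| ^ n)%N.
Proof. by rewrite card_mx mul1n. Qed.

Lemma card_field_gt0 : (0 < #|F|)%N.
Proof. by apply/card_gt0P; exists 0. Qed.

Lemma card_notsubmx m n (B : 'M[F]_(m, n)) :
  #|[set r : 'rV[F]_n | ~~ (r <= B)%MS]%SET| = (#|F| ^ n - #|F| ^ \rank B)%N.
Proof.
rewrite cardsCs card_rV -card_submx; congr (_ - _)%N; apply: eq_card => r.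
by rewrite !inE negbK.
Qed.

(* For a block [B] with [s] rows: the class born with its first row is still
   alive after its last row, and [j] classes of the block are alive. *)
Definition alive s j m n (B : 'M[F]_(m, n.+1)) :=
  ~~ (e0 <= B)%MS && (\rank B + j == s)%N.

(** By exchange, the first class survives exactly when the new row lies in [B], which adds a live
    class, or outside [B + e0], which keeps their number. *)
Lemma alive_step (R : realFieldType) t j (B : 'M[F]_(t, t.+1)) :
  #|[set r : 'rV[F]_t.+1 | alive t.+1 j (col_mx B r)]%SET|%:R / #|F|%:R ^+ t.+1 =
  (alive t j B)%:R * (1 - #|F|%:R ^- j) +
  ((0 < j)%N && alive t j.-1 B)%:R * #|F|%:R ^- j :> R.
Proof.
have q0 : (#|F|%:R : R) != 0 by rewrite pnatr_eq0 -lt0n card_field_gt0.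
rewrite /alive; have [eB|eB] /= := boolP (e0 <= B)%MS.
  rewrite andbF !mul0r addr0 (eq_card0 _) ?mul0r// => r.
  by rewrite !inE -addsmxE (submx_trans eB (addsmxSl _ _)).
have rB := rank_leq_row B.
under eq_finset => r do
  rewrite exchange_submx// rank_col_mx negb_and negbK -addnA.
(* Already [j] live classes: only rows outside [B + e0] count, and that space has dimension
   [t + 1 - j]. *)
have [e1|n1] := eqVneq (\rank B + j)%N t.
  have -> : ((0 < j)%N && (\rank B + j.-1 == t)%N) = false.
    by apply/negP => /andP[j0 /eqP]; lia.
  rewrite mul0r addr0 mul1r.
  have -> : [set r : 'rV[F]_t.+1 | ((r <= B)%MS || ~~ (r <= col_mx B e0)%MS) &&
      (\rank B + (~~ (r <= B)%MS + j) == t.+1)%N]%SET =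
      [set r : 'rV[F]_t.+1 | ~~ (r <= col_mx B e0)%MS]%SET.
    apply/setP => r; rewrite !inE; have [rB'|rB'] /= := boolP (r <= B)%MS.
      have -> : (r <= col_mx B e0)%MS.
        by rewrite -addsmxE (submx_trans rB' (addsmxSl _ _)).
      by rewrite add0n e1 ltn_eqF.
    by rewrite addnCA e1 add1n eqxx andbT.
  rewrite card_notsubmx rank_col_mx eB addn1 natrB; last first.
    by rewrite leq_pexp2l ?card_field_gt0//; lia.
  rewrite !natrX mulrBl divff ?expf_neq0//; congr (_ - _).
  have -> : #|F|%:R ^+ t.+1 = #|F|%:R ^+ (\rank B).+1 * #|F|%:R ^+ j :> R.
    by rewrite -exprD addSn e1.
  by rewrite invfM mulrA divff ?expf_neq0// mul1r.
rewrite mul0r add0r.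
(* So far [j - 1] live classes: only rows of [B] count, a space of dimension [t + 1 - j]. *)
have [e2|n2] := eqVneq (\rank B + j)%N t.+1.
  have -> : ((0 < j)%N && (\rank B + j.-1 == t)%N) = true.
    by apply/andP; split; [|apply/eqP]; lia.
  rewrite mul1r.
  have -> : [set r : 'rV[F]_t.+1 | ((r <= B)%MS || ~~ (r <= col_mx B e0)%MS) &&
      (\rank B + (~~ (r <= B)%MS + j) == t.+1)%N]%SET =
      [set r : 'rV[F]_t.+1 | (r <= B)%MS]%SET.
    apply/setP => r; rewrite !inE; have [rB'|rB'] /= := boolP (r <= B)%MS.
      by rewrite add0n e2 eqxx.
    by rewrite addnCA e2 -[X in _ == X]add0n eqn_add2r andbF.
  have -> : #|F|%:R ^+ t.+1 = #|F|%:R ^+ \rank B * #|F|%:R ^+ j :> R.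
    by rewrite -exprD e2.
  by rewrite card_submx natrX invfM mulrA divff ?expf_neq0// mul1r.
have -> : ((0 < j)%N && (\rank B + j.-1 == t)%N) = false.
  by apply/negP => /andP[j0 /eqP]; move/eqP: n2; lia.
rewrite mul0r (eq_card0 _) ?mul0r// => r; rewrite !inE.
apply/negP => /andP[_]; case: (_ <= B)%MS => /eqP /=.
  by move/eqP: n2; lia.
by move/eqP: n1; lia.
Qed.

(** The killing rows are those in [B + e0] but not in [B], a difference of two nested subspaces of
    consecutive dimensions. *)
Lemma death_step (R : realFieldType) t (B : 'M[F]_(t, t.+1)) :
  ~~ (e0 <= B)%MS ->
  #|[set r : 'rV[F]_t.+1 | (e0 <= col_mx B r)%MS]%SET|%:R / #|F|%:R ^+ t.+1 =
  #|F|%:R ^- (t - \rank B) * (1 - #|F|%:R^-1) :> R.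
Proof.
have q0 : (#|F|%:R : R) != 0 by rewrite pnatr_eq0 -lt0n card_field_gt0.
move=> eB.
have -> : [set r : 'rV[F]_t.+1 | (e0 <= col_mx B r)%MS]%SET =
    [set r : 'rV[F]_t.+1 | (r <= col_mx B e0)%MS]%SET :\:
    [set r : 'rV[F]_t.+1 | (r <= B)%MS]%SET.
  by apply/setP => r; rewrite !inE exchange_submx.
rewrite cardsD (finset.setIidPr _); last first.
  apply/fintype.subsetP => r; rewrite !inE -addsmxE => rB.
  exact: submx_trans rB (addsmxSl _ _).
rewrite !card_submx rank_col_mx eB addn1 natrB; last first.
  by rewrite leq_pexp2l ?card_field_gt0.
have rB := rank_leq_row B.
have -> : #|F|%:R ^+ t.+1 =
    #|F|%:R ^+ (\rank B).+1 * #|F|%:R ^+ (t - \rank B) :> R.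
  by rewrite -exprD addSn subnKC.
rewrite !natrX invfM mulrA mulrC; congr (_ * _).
by rewrite mulrBl divff ?expf_neq0// exprS invfM mulrCA divff ?expf_neq0// mulr1.
Qed.

End RowCounting.

(** * Real-valued probabilities and finite independence *)

Section RealProbability.
Context {d : measure_display} {T : measurableType d} {R : realType}.
Variable P : probability T R.

Definition pr (A : set T) : R := fine (P A).

Lemma prE A : measurable A -> P A = (pr A)%:E.
Proof. by move=> mA; rewrite fineK//; exact: fin_num_measure. Qed.

Lemma pr_EFin A r : P A = r%:E -> pr A = r.
Proof. by rewrite /pr => ->. Qed.

Lemma pr0 : pr set0 = 0.
Proof. by rewrite /pr measure0. Qed.

Lemma prT : pr setT = 1.
Proof. by rewrite /pr probability_setT. Qed.

Lemma pr_ge0 A : 0 <= pr A.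
Proof. by apply: fine_ge0; exact: measure_ge0. Qed.

(** The list [r] need only contain the values taken on [A], so [Q] may have infinite range. *)
Lemma pr_total {V : choiceType} (Q : T -> V) (r : seq V) (A : set T) :
  uniq r -> measurable A ->
  (forall v, v \in r -> measurable (Q @^-1` [set v])) ->
  (forall w, A w -> Q w \in r) ->
  pr A = \sum_(v <- r) pr (A `&` Q @^-1` [set v]).
Proof.
move=> ur mA mQ Ar.
have AE : A = \bigcup_(v in [set` r]) (A `&` Q @^-1` [set v]).
  apply/seteqP; split=> [w Aw|w [v _ [//]]].
  by exists (Q w) => //=; exact: Ar.
apply: EFin_inj; rewrite -prE// {1}AE measure_fin_bigcup//.
- rewrite -fsbig_seq// -sumEFin big_seq [RHS]big_seq; apply: eq_bigr => v vr.
  by rewrite -prE//; apply: measurableI => //; exact: mQ.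
- by move=> i j _ _ [w [[_ <-] [_ <-]]].
- by move=> i ir; apply: measurableI => //; exact: mQ.
Qed.

End RealProbability.

(** * Events determined by finitely many independent variables *)

Section FiniteIndependence.
Context {d : measure_display} {T : measurableType d} {R : realType}.
Variable P : probability T R.
Context {E : finType} {I : choiceType} (J : set I) (X : I -> T -> E).
Hypothesis mX : forall i, J i -> discrete_rv (X i).
Hypothesis indX : mutually_independent P J X.
Local Notation pr := (pr P).

Definition cyl (S : {fset I}) (a : I -> E) : set T :=
  [set w | forall i, i \in S -> X i w = a i].

Lemma cylE S a : cyl S a = \bigcap_(i in [set` S]) (X i @^-1` [set a i]).
Proof. by []. Qed.

Lemma measurable_cyl S a : [set` S] `<=` J -> measurable (cyl S a).
Proof.
move=> SJ; rewrite cylE; apply: fin_bigcap_measurable => // i iS.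
by apply: mX; exact: SJ.
Qed.

Lemma pr_cyl S a : [set` S] `<=` J ->
  pr (cyl S a) = \prod_(i <- S) pr (X i @^-1` [set a i]).
Proof.
move=> SJ; apply: EFin_inj; rewrite -prE; last exact: measurable_cyl.
rewrite cylE indX// -prodEFin big_seq [RHS]big_seq; apply: eq_bigr => i iS.
by rewrite prE//; apply: mX; exact: SJ.
Qed.

Definition depends_on (S : {fset I}) (p : pred (I -> E)) :=
  forall x y, (forall i, i \in S -> x i = y i) -> p x = p y.

Definition event (p : pred (I -> E)) : set T := [set w | p (X ^~ w)].

Lemma event_eq {V : eqType} (Q : (I -> E) -> V) v :
  (fun w => Q (X ^~ w)) @^-1` [set v] = event (fun x => Q x == v).
Proof. by apply/seteqP; split=> w /eqP. Qed.

(** Patterns on [S] form a finite type, so an event depending on [S] is a finite union of cylinders;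
    [extend] fills in the dummy value [x0] outside [S]. *)
Definition pattern (S : {fset I}) (w : T) : {ffun S -> E} :=
  [ffun s => X (val s) w].

Definition extend (x0 : E) (S : {fset I}) (f : {ffun S -> E}) (i : I) : E :=
  if insub i is Some s then f s else x0.

Lemma extend_pattern x0 S w i : i \in S -> extend x0 (pattern S w) i = X i w.
Proof. by move=> iS; rewrite /extend insubT ffunE. Qed.

Lemma pattern_cyl x0 S f : pattern S @^-1` [set f] = cyl S (extend x0 f).
Proof.
apply/seteqP; split=> [w <- i iS|w wS].
  by rewrite extend_pattern.
apply/ffunP => s; rewrite ffunE wS ?fsvalP// /extend.
by rewrite insubT ?fsvalP//= => h; congr (f _); exact: val_inj.
Qed.

Lemma event_pattern x0 S p w : depends_on S p ->
  event p w = p (extend x0 (pattern S w)).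
Proof.
move=> dp; rewrite /event/=; congr is_true; apply: dp => i iS.
by rewrite extend_pattern.
Qed.

(** Disjointness lets both prescriptions be glued into one cylinder on the union, to which the
    product formula applies. *)
Lemma pr_cylI S1 S2 a b : [set` S1] `<=` J -> [set` S2] `<=` J ->
  [disjoint S1 & S2]%fset ->
  pr (cyl S1 a `&` cyl S2 b) = pr (cyl S1 a) * pr (cyl S2 b).
Proof.
move=> S1J S2J dis.
pose c i := if i \in S1 then a i else b i.
have n1 i : i \in S2 -> (i \in S1) = false.
  by move=> iS2; apply/negbTE; apply: contraTN iS2; exact: (fdisjointP dis).
have -> : cyl S1 a `&` cyl S2 b = cyl (S1 `|` S2)%fset c.
  apply/seteqP; split=> [w [w1 w2] i|w wc].
    rewrite in_fsetU /c; case: ifPn => [iS _|_ /= iS]; [exact: w1|exact: w2].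
  split=> i iS; rewrite wc ?in_fsetU ?iS ?orbT// /c ?iS//.
  by rewrite n1.
rewrite !pr_cyl//; last by move=> i /=; rewrite in_fsetU => /orP[/S1J|/S2J].
rewrite (perm_big (S1 ++ S2)); last first.
  apply: uniq_perm; rewrite ?fset_uniq ?cat_uniq ?fset_uniq ?andbT//=.
    apply/hasPn => i /= iS2; rewrite n1//.
  by move=> i; rewrite mem_cat in_fsetU.
rewrite big_cat/=; congr (_ * _).
  by rewrite big_seq [RHS]big_seq; apply: eq_bigr => i iS; rewrite /c iS.
by rewrite big_seq [RHS]big_seq; apply: eq_bigr => i iS; rewrite /c n1.
Qed.

Variable x0 : E.

Lemma measurable_event S p : [set` S] `<=` J -> depends_on S p ->
  measurable (event p).
Proof.
move=> SJ dp.
have -> : event p =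
    \bigcup_(f in [set f : {ffun S -> E} | p (extend x0 f)]) cyl S (extend x0 f).
  apply/seteqP; split=> [w|w [f pf]].
    rewrite (event_pattern x0 w dp) => pw; exists (pattern S w) => //.
    by rewrite -pattern_cyl.
  by rewrite -pattern_cyl (event_pattern x0 w dp)/= => ->.
apply: fin_bigcup_measurable => [|f _]; last exact: measurable_cyl.
exact: finite_finset.
Qed.

Lemma pr_event (A : set T) S p : [set` S] `<=` J -> depends_on S p ->
  measurable A ->
  pr (A `&` event p) =
  \sum_(f : {ffun S -> E} | p (extend x0 f)) pr (A `&` cyl S (extend x0 f)).
Proof.
move=> SJ dp mA.
rewrite (@pr_total _ _ _ P _ (pattern S) (index_enum _)) ?index_enum_uniq//.
- rewrite [RHS]big_mkcond; apply: eq_bigr => f _.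
  rewrite -pattern_cyl -setIA; case: ifPn => pf.
    congr (pr (_ `&` _)); apply/seteqP; split=> [w []//|w wf]; split=> //.
    by rewrite (event_pattern x0 w dp) wf.
  rewrite (_ : _ `&` _ = set0) ?pr0//; apply/seteqP; split=> // w [_ []].
  by rewrite (event_pattern x0 w dp) => /[swap] ->; rewrite (negPf pf).
- by apply: measurableI => //; exact: measurable_event dp.
- by move=> f _; rewrite (pattern_cyl x0); exact: measurable_cyl.
- by move=> w _; rewrite mem_index_enum.
Qed.

Lemma pr_eventI S1 S2 p1 p2 : [set` S1] `<=` J -> [set` S2] `<=` J ->
  [disjoint S1 & S2]%fset -> depends_on S1 p1 -> depends_on S2 p2 ->
  pr (event p1 `&` event p2) = pr (event p1) * pr (event p2).
Proof.
move=> S1J S2J dis d1 d2.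
have m1 := measurable_event S1J d1.
rewrite (pr_event S2J d2 m1) -[event p2]setTI (pr_event S2J d2 measurableT).
rewrite mulr_sumr; apply: eq_bigr => f2 _; rewrite setTI setIC.
have m2 := measurable_cyl (extend x0 f2) S2J.
rewrite (pr_event S1J d1 m2) -[event p1]setTI (pr_event S1J d1 measurableT).
rewrite mulr_suml; apply: eq_bigr => f1 _; rewrite setTI setIC.
exact: pr_cylI.
Qed.

End FiniteIndependence.

(** * Sums of independent geometric variables *)

Section Profile.
Context {R : realFieldType}.
Variable q : R.

(* [profile t j] is both the probability that [Y 1 + ... + Y j = t] and the
   probability that a class of age [t] is alive and is the [j]-th youngest
   class alive. *)
Fixpoint profile (t j : nat) : R :=
  if t is t'.+1 then
    profile t' j * (1 - q ^- j) + (0 < j)%N%:R * (profile t' j.-1 * q ^- j)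
  else (j == 0)%:R.

Lemma profileS0 t : profile t.+1 0 = 0.
Proof. by rewrite /= expr0 invr1 subrr mulr0 mul0r addr0. Qed.

(** Unrolling the recursion in [t] shows the convolution with the geometric law of parameter
    [q ^- j.+1]; the index [i] stands for the value [i + 1]. *)
Lemma profile_convolution t j : profile t j.+1 =
  \sum_(i < t) profile (t - i.+1) j * (q ^- j.+1 * (1 - q ^- j.+1) ^+ i).
Proof.
elim: t => [|t IH]; first by rewrite big_ord0.
rewrite big_ord_recl/= mul1r subn1/= expr0 mulr1 addrC; congr (_ + _).
rewrite IH mulr_suml; apply: eq_bigr => i _.
by rewrite /bump/= add1n subSS (exprSr _ i) !mulrA.
Qed.

End Profile.

Section GeometricSum.
Context {d : measure_display} {T : measurableType d} {R : realType}.
Variables (P : probability T R) (q : R) (G : T -> nat) (Y : nat -> T -> nat).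
Hypothesis q0 : q != 0.
Hypothesis Ggeom : shifted_geometric P ((q - 1) / q) G.
Hypothesis Ygeom :
  forall i : nat, (1 <= i)%N -> shifted_geometric P (q ^- i) (Y i).
Hypothesis GYindep : mutually_independent P [set: nat]
  (fun i => if i is 0%N then G else Y i).
Local Notation pr := (pr P).

Let GY i := if i is 0%N then G else Y i.

Let GY_discrete i : discrete_rv (GY i).
Proof. by case: i => [|i]; [case: Ggeom|case: (Ygeom (ltn0Sn i))]. Qed.

Let rect (S : {fset nat}) (A : nat -> set nat) : set T :=
  \bigcap_(i in [set` S]) (GY i @^-1` A i).

Let measurable_rect S A : measurable (rect S A).
Proof. by apply: fin_bigcap_measurable => // i _; exact: GY_discrete. Qed.

Let pr_rect S A : pr (rect S A) = \prod_(i <- S) pr (GY i @^-1` A i).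
Proof.
apply: EFin_inj; rewrite -prE// GYindep// -prodEFin; apply: eq_bigr => i _.
by rewrite prE//; exact: GY_discrete.
Qed.

Definition partial_sum n w := (\sum_(1 <= i < n.+1) Y i w)%N.

Lemma partial_sumS n w : partial_sum n.+1 w = (partial_sum n w + Y n.+1 w)%N.
Proof. by rewrite /partial_sum big_nat_recr. Qed.

Lemma measurable_partial_sum n k : measurable (partial_sum n @^-1` [set k]).
Proof.
elim: n k => [|n IH] k.
  have [->|k0] := eqVneq k 0%N.
    rewrite (_ : _ @^-1` _ = setT)//; apply/seteqP; split=> // w _ /=.
    by rewrite /partial_sum big_geq.
  rewrite (_ : _ @^-1` _ = set0)//; apply/seteqP; split=> // w /=.
  by rewrite /partial_sum big_geq// => k0'; rewrite -k0' eqxx in k0.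
rewrite (_ : _ @^-1` _ = \bigcup_(m in `I_k.+1)
    (partial_sum n @^-1` [set (k - m)%N] `&` Y n.+1 @^-1` [set m])).
  apply: fin_bigcup_measurable => // m _; apply: measurableI; first exact: IH.
  exact: (GY_discrete n.+1).
apply/seteqP; split=> [w /= e|w [m /= mk [e1 e2]]].
  exists (Y n.+1 w) => /=; first by rewrite ltnS -e partial_sumS leq_addl.
  by split=> //; rewrite -e partial_sumS addnK.
by rewrite partial_sumS e1 e2 subnK.
Qed.

(** The rectangle over [G] (index 0) and later variables carries joint independence through the
    induction: conditioning on [Y n.+1] moves its index into [S]. *)
Let pr_partial_sum_rect n k S A : (forall i, i \in S -> i = 0 \/ (n < i)%N) ->
  pr (partial_sum n @^-1` [set k] `&` rect S A) = profile q k n * pr (rect S A).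
Proof.
elim: n k S A => [|n IH] k S A Sn.
  case: k => [|k].
    rewrite /= mul1r; congr pr; rewrite -[RHS]setTI; congr (_ `&` _).
    by apply/seteqP; split=> // w _ /=; rewrite /partial_sum big_geq.
  rewrite profileS0 mul0r (_ : _ `&` _ = set0) ?pr0//.
  by apply/seteqP; split=> // w [/=]; rewrite /partial_sum big_geq.
have nS : n.+1 \notin S by apply/negP => /Sn[//|]; rewrite ltnn.
have [_ Y1 pY] := Ygeom (ltn0Sn n).
rewrite (@pr_total _ _ _ P _ (Y n.+1) (iota 1 k)) ?iota_uniq//; last first.
- move=> w [/= e _]; rewrite mem_iota Y1/= add1n ltnS -e partial_sumS.
  exact: leq_addl.
- by move=> m _; exact: (GY_discrete n.+1).
- apply: measurableI => //; exact: measurable_partial_sum.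
rewrite profile_convolution mulr_suml.
rewrite -[1%N]addn0 iotaDl big_map -{1}[k]subn0 -/(index_iota 0 k) big_mkord.
apply: eq_bigr => i _.
(* The enlarged rectangle also prescribes [Y n.+1 = i + 1]. *)
pose A' m := if m == n.+1 then [set i.+1] else A m.
have AA' : \prod_(m <- S) pr (GY m @^-1` A' m) = \prod_(m <- S) pr (GY m @^-1` A m).
  rewrite big_seq [RHS]big_seq; apply: eq_bigr => m mS; rewrite /A' ifF//.
  by apply: contraNF nS => /eqP <-.
have -> : partial_sum n.+1 @^-1` [set k] `&` rect S A `&`
      Y n.+1 @^-1` [set (1 + i)%N] =
    partial_sum n @^-1` [set (k - i.+1)%N] `&` rect (n.+1 |` S)%fset A'.
  apply/seteqP; split=> [w [[/= e1 e2] e3]|w [/= e1 e2]].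
    split; first by move: e1 e3; rewrite /= partial_sumS; lia.
    move=> m /=; rewrite in_fset1U => /orP[/eqP->|mS]; first by rewrite /A' eqxx.
    rewrite /A' ifF; first exact: e2.
    by apply: contraNF nS => /eqP <-.
  have e3 : Y n.+1 w = i.+1.
    by have := e2 n.+1; rewrite /= in_fset1U eqxx /A' eqxx => /(_ isT).
  split=> //; split; first by have := ltn_ord i; rewrite /= partial_sumS e1 e3; lia.
  move=> m mS; have := e2 m; rewrite /= in_fset1U mS orbT => /(_ isT).
  by rewrite /A' ifF//; apply: contraNF nS => /eqP <-.
rewrite IH; last first.
  move=> m; rewrite in_fset1U => /orP[/eqP->|/Sn[->|/ltnW ?]];
    [by right|by left|by right].
rewrite -mulrA; congr (_ * _).
rewrite !pr_rect big_fsetU1//= AA' /A' eqxx; congr (_ * _).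
by rewrite /pr pY//= subn1.
Qed.

Let geometric_sumE w :
  (\sum_(1 <= i < G w) Y i w)%N = partial_sum (G w).-1 w.
Proof. by have [_ G1 _] := Ggeom; rewrite /partial_sum prednK. Qed.

Lemma measurable_geometric_sum k :
  measurable ((fun w => \sum_(1 <= i < G w) Y i w)%N @^-1` [set k]).
Proof.
have [mG _ _] := Ggeom.
rewrite (_ : _ @^-1` _ =
    \bigcup_g (G @^-1` [set g] `&` partial_sum g.-1 @^-1` [set k])).
  apply: bigcup_measurable => g _; apply: measurableI; first exact: mG.
  exact: measurable_partial_sum.
apply/seteqP; split=> [w /= e|w [g _ [/= e1 e2]]].
  by exists (G w) => //; split=> //=; rewrite -geometric_sumE.
by rewrite geometric_sumE e1.
Qed.

(** The sum splits over [G = j + 1], which has probability [q ^- j * (1 - q^-1)]. Each [Y i] is at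
    least 1, so [j] summands adding up to [k] force [j <= k]. *)
Lemma pr_geometric_sum k :
  pr ((fun w => \sum_(1 <= i < G w) Y i w)%N @^-1` [set k]) =
  \sum_(j < k.+1) profile q k j * (q ^- j * (1 - q^-1)).
Proof.
have [mG G1 pG] := Ggeom; have SE := geometric_sumE.
have leS n w : (n <= partial_sum n w)%N.
  elim: n => // n IH; rewrite partial_sumS -[X in (X <= _)%N]addn1 leq_add//.
  by have [_ Y1 _] := Ygeom (ltn0Sn n); exact: Y1.
rewrite (@pr_total _ _ _ P _ G (iota 1 k.+1)) ?iota_uniq//; last first.
- move=> w; rewrite mem_iota G1 /preimage/= SE add1n => <-.
  by rewrite !ltnS -[X in (X <= _)%N]prednK// ltnS.
- exact: measurable_geometric_sum.
rewrite -[1%N]addn0 iotaDl big_map -{1}[k.+1]subn0 -/(index_iota 0 k.+1) big_mkord.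
apply: eq_bigr => j _.
pose A m := if m == 0%N then [set j.+1] else setT.
rewrite (_ : _ `&` _ = partial_sum j @^-1` [set k] `&` rect [fset 0%N]%fset A).
  rewrite pr_partial_sum_rect; last by move=> i; rewrite inE => /eqP->; left.
  rewrite pr_rect big_seq_fset1 /A eqxx/= /pr pG//= subn1/=.
  by rewrite mulrBl divff// mul1r subKr exprVn [_ * (1 - _)]mulrC.
apply/seteqP; split=> [w [/= e1 e2]|w [/= e1 e2]].
  split; first by move: e1; rewrite SE e2.
  by move=> i /=; rewrite inE => /eqP-> /=; rewrite /A eqxx.
have e3 : G w = j.+1.
  by have := e2 0%N; rewrite /= inE eqxx /A eqxx => /(_ isT).
by split=> //=; rewrite SE e3.
Qed.

End GeometricSum.

(** * Countable additivity for real-valued probabilities *)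

Section TotalMass.
Context {d : measure_display} {T : measurableType d} {R : realType}.

Lemma cvg_pr_bigcup (P : probability T R) (A : nat -> set T) :
  (forall k, measurable (A k)) -> trivIset setT A ->
  (fun n => \sum_(k < n) pr P (A k)) @ \oo --> pr P (\bigcup_k A k).
Proof.
move=> mA tA; have mU : measurable (\bigcup_k A k) by exact: bigcup_measurable.
have := @measure_semi_sigma_additive _ _ _ P A mA tA mU.
rewrite [X in _ --> X -> _](_ : _ = (pr P (\bigcup_k A k))%:E); last exact: prE.
rewrite (_ : (fun n => _) = (fun n => (\sum_(k < n) pr P (A k))%:E)).
  by move=> /fine_cvgP[_].
apply/funext => n; rewrite big_mkord -sumEFin; apply: eq_bigr => k _.
exact: prE.
Qed.

Lemma pr_nat_total (P : probability T R) (X : T -> nat) :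
  (forall k, measurable (X @^-1` [set k])) ->
  (fun n => \sum_(k < n) pr P (X @^-1` [set (k : nat)])) @ \oo --> (1 : R).
Proof.
move=> mX; rewrite -(prT P) (_ : setT = \bigcup_k (X @^-1` [set k])).
  by apply: cvg_pr_bigcup => // i j _ _ [w [/= -> ->]].
by apply/seteqP; split=> // w _; exists (X w).
Qed.

End TotalMass.

(** * A strong law for finitely dependent events *)

Lemma square_bracket n : (0 < n)%N ->
  exists m, (m.+1 ^ 2 <= n < m.+2 ^ 2)%N.
Proof.
elim: n => // -[|n] IH _; first by exists 0%N.
have [m /andP[m1 m2]] := IH isT.
have [lt|ge] := ltnP n.+2 (m.+2 ^ 2); first by exists m; rewrite lt leqW.
by exists m.+1; rewrite ge/=; nia.
Qed.

(** Consecutive squares are [2m + 3] apart, negligible against [(m + 1) ^ 2], and increments in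
    [[0, 1]] cannot move the mean more than that allows. *)
Lemma cvg_mean_squares (R : realType) (S : nat -> R) (p : R) :
  (forall n, 0 <= S n.+1 - S n <= 1) ->
  S (n.+1 ^ 2)%N / (n.+1 ^ 2)%:R @[n --> \oo] --> p ->
  S n / n%:R @[n --> \oo] --> p.
Proof.
move=> Sinc Ssq.
have Sdiff M k : 0 <= S (M + k)%N - S M <= k%:R.
  elim: k => [|k /andP[h1 h2]]; first by rewrite addn0 subrr lexx.
  have /andP[h3 h4] := Sinc (M + k)%N.
  by rewrite addnS -natr1; apply/andP; split; lra.
(* The error at the preceding square, plus a bound for the at most [2 * m.+1] later terms divided by
   at least [m.+1 ^ 2]. *)
pose err m := `|p - S (m.+1 ^ 2)%N / (m.+1 ^ 2)%:R| + 2 * (1 + `|p|) * (m.+1%:R)^-1.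
have err0 : err @ \oo --> (0 : R).
  rewrite -[X in _ --> X]addr0; apply: cvgD.
    rewrite -(@normr0 _ R); apply: cvg_norm.
    by rewrite -[X in _ --> X](subrr p); apply: cvgB => //; exact: cvg_cst.
  rewrite -[X in _ --> X](mulr0 (2 * (1 + `|p|))).
  by apply: cvgMr; exact: cvg_harmonic.
apply/cvgrPdist_lt => e e0.
have [K _ HK] := (cvgrPdist_lt _ _).1 err0 e e0.
exists (K.+1 ^ 2)%N => // n /= Kn.
have n0 : (0 < n)%N by apply: leq_trans Kn; rewrite expn_gt0.
have [m /andP[m1 m2]] := square_bracket n0.
have Km : (K <= m)%N by rewrite -ltnS -ltnS -(ltn_exp2r _ _ (isT : 0 < 2)%N); lia.
have := HK m Km; rewrite sub0r normrN ger0_norm; last first.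
  by rewrite addr_ge0// mulr_ge0// ?invr_ge0// mulr_ge0// addr_ge0.
apply: le_lt_trans.
set M := (m.+1 ^ 2)%N.
have nE : n = (M + (n - M))%N by rewrite subnKC.
set k := (n - M)%N in nE *.
have k2 : (k <= 2 * m.+1)%N by rewrite /k /M; move: m1 m2; rewrite /M; nia.
have M0 : 0 < M%:R :> R by rewrite ltr0n expn_gt0.
have m10 : 0 < m.+1%:R :> R by rewrite ltr0n.
have N0 : 0 < n%:R :> R by rewrite ltr0n.
have ME : M%:R = m.+1%:R * m.+1%:R :> R by rewrite /M natrX expr2.
have nR : n%:R = M%:R + k%:R :> R by rewrite [in LHS]nE natrD.
have kR : k%:R <= 2 * m.+1%:R :> R by rewrite -natrM ler_nat.
have k0 : 0 <= k%:R :> R by [].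
have Sd := Sdiff M k; rewrite -nE in Sd; move: Sd => /andP[s0 sk].
have -> : p - S n / n%:R =
    ((p - S M / M%:R) * M%:R + (p * k%:R - (S n - S M))) / n%:R.
  by rewrite nR; field; rewrite -nR !gt_eqF.
rewrite normrM normfV (ger0_norm (ltW N0)) ler_pdivrMr//.
apply: le_trans (ler_normD _ _) _; rewrite [X in _ <= X]mulrDl lerD//.
  rewrite normrM (ger0_norm (ltW M0)) ler_wpM2l// nR; lra.
apply: le_trans (ler_normB _ _) _; rewrite normrM (ger0_norm s0) (ger0_norm k0).
apply: (@le_trans _ _ ((1 + `|p|) * k%:R)); first by rewrite mulrDl mul1r addrC lerD.
rewrite (_ : 2 * _ * _ * _ = (1 + `|p|) * (2 * m.+1%:R^-1 * n%:R)); last by ring.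
rewrite ler_wpM2l ?addr_ge0//; apply: le_trans kR _.
rewrite -mulrA ler_pM2l// -{1}[m.+1%:R](mulKf (lt0r_neq0 m10)).
by rewrite ler_wpM2l ?invr_ge0// nR ME lerDl.
Qed.

Section StrongLaw.
Context {d : measure_display} {T : measurableType d} {R : realType}.
Variables (P : probability T R) (E : nat -> set T) (p : R) (m : nat).
Hypothesis mE : forall i, measurable (E i).
Hypothesis prEi : forall i, pr P (E i) = p.
Hypothesis prEij : forall i j, (i + m <= j)%N -> pr P (E i `&` E j) = p ^+ 2.
Local Notation pr := (pr P).

Let S n w : R := \sum_(i < n) \1_(E i) w.

Let measurable_S n : measurable_fun setT (S n).
Proof. by apply: measurable_sum => i; exact: measurable_indic. Qed.

Let pr_le1 A : measurable A -> pr A <= 1.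
Proof. by move=> mA; rewrite -lee_fin -prE//; exact: probability_le1. Qed.

Let p0 : 0 <= p.
Proof. by rewrite -(prEi 0); exact: pr_ge0. Qed.

Let integral_indic_sum (I : finType) (A : I -> set T) :
  (forall i, measurable (A i)) ->
  (\int[P]_w (\sum_i \1_(A i) w)%:E = (\sum_i pr (A i))%:E)%E.
Proof.
move=> mA; under eq_integral do rewrite -sumEFin.
rewrite ge0_integral_sum//=.
- by rewrite -sumEFin; apply: eq_bigr => i _; rewrite integral_indic// setIT; exact: prE.
- by move=> i; apply/measurable_EFinP; exact: measurable_indic.
Qed.

Let count_near n i :
  \sum_(j < n) ((i < j + m) && (j < i + m))%N%:R <= (2 * m)%:R :> R.
Proof.
rewrite -natr_sum ler_nat.
(* The near indices form the interval from [i + 1 - m] to [i + m - 1]; cutting it at [n] gives a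
   bound that goes through induction on [n]. *)
suff : (\sum_(j < n) ((i < j + m) && (j < i + m))%N <=
  minn n (i + m) - minn n (i.+1 - m))%N by move=> /leq_trans; apply; lia.
elim: n => [|n IH]; first by rewrite big_ord0.
rewrite big_ord_recr/=; move: IH.
by case: (ltnP i (n + m)); case: (ltnP n (i + m)) => /= *; lia.
Qed.

(** Pairs at distance at least [m] contribute [p ^+ 2], which the centering cancels. Each index has
    at most [2 * m] near partners, each contributing at most 1, so the variance grows only
    linearly. *)
Let second_moment n :
  (\int[P]_w ((S n w - n%:R * p) ^+ 2)%:E <= (n%:R * (2 * m)%:R)%:E)%E.
Proof.
have np0 : 0 <= n%:R * p by rewrite mulr_ge0.
set a := 2 * (n%:R * p).
have a0 : 0 <= a by rewrite mulr_ge0.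
have S0 w : 0 <= S n w by apply: sumr_ge0 => i _.
have mg : measurable_fun setT (fun w => ((S n w - n%:R * p) ^+ 2)%:E).
  apply/measurable_EFinP; apply: measurable_funX.
  by apply: measurable_funB.
(* The cross term of the square is moved to the other side, so that only
   nonnegative functions are integrated. *)
rewrite -(@leeD2rE _ (a * (n%:R * p))%:E)//.
have intS : (\int[P]_w (a * S n w)%:E = (a * (n%:R * p))%:E)%E.
  under eq_integral do rewrite EFinM.
  rewrite ge0_integralZl//; last 2 first.
  - by apply/measurable_EFinP.
  - by move=> w _; rewrite lee_fin.
  rewrite integral_indic_sum// EFinM; congr (_ * _%:E)%E.
  by under eq_bigr do rewrite prEi; rewrite sumr_const card_ord mulr_natl.
rewrite -{1}intS -ge0_integralD//=; last 3 first.
- by move=> w _; rewrite lee_fin sqr_ge0.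
- by move=> w _; rewrite lee_fin mulr_ge0.
- by apply/measurable_EFinP; apply: measurable_funM.
under eq_integral => w _.
  rewrite -EFinD (_ : _ + _ = \sum_(ij : 'I_n * 'I_n) \1_(E ij.1 `&` E ij.2) w
    + (n%:R * p) ^+ 2); last first.
    transitivity (S n w ^+ 2 + (n%:R * p) ^+ 2); first by rewrite /a; ring.
    congr (_ + _); rewrite expr2 /S big_distrlr/= pair_big/=.
    by apply: eq_bigr => ij _; rewrite indicI.
  rewrite EFinD; over.
rewrite ge0_integralD//=; last 3 first.
- by move=> w _; rewrite lee_fin sumr_ge0.
- apply/measurable_EFinP; apply: measurable_sum => ij.
  by apply: measurable_indic; exact: measurableI.
- by move=> w _; rewrite lee_fin sqr_ge0.
rewrite integral_indic_sum; last by move=> ij; exact: measurableI.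
rewrite integral_cst// [X in (_ * X)%E](_ : _ = 1%:E); last exact: probability_setT.
rewrite mule1 -!EFinD lee_fin.
rewrite -lerBrDr (_ : _ - _ = n%:R * (2 * m)%:R + (n%:R * p) ^+ 2); last first.
  by rewrite /a; ring.
pose near (i j : nat) := ((i < j + m) && (j < i + m))%N.
apply: (@le_trans _ _ (\sum_(i < n) \sum_(j < n) ((near i j)%:R + p ^+ 2))).
  rewrite pair_big/=; apply: ler_sum => -[i j] _ /=.
  have [nij|] := boolP (near i j).
    apply: (@le_trans _ _ 1); first by apply: pr_le1; exact: measurableI.
    by rewrite lerDl sqr_ge0.
  rewrite /near negb_and -!leqNgt add0r => /orP[|] h; last by rewrite prEij.
  by rewrite setIC prEij.
under eq_bigr do rewrite big_split/=.
rewrite big_split/= lerD//.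
  apply: (@le_trans _ _ (\sum_(i < n) (2 * m)%:R)).
    by apply: ler_sum => i _; exact: count_near.
  by rewrite sumr_const card_ord mulr_natl.
rewrite !sumr_const !card_ord -[X in X <= _]mulr_natl -[p ^+ 2 *+ n]mulr_natl.
by rewrite (_ : _ * _ = (n%:R * p) ^+ 2)//; ring.
Qed.

Let h k w : \bar R := (((S (k.+1 ^ 2)%N w / (k.+1 ^ 2)%:R - p)) ^+ 2)%:E.

Let h0 k w : (0 <= h k w)%E.
Proof. by rewrite lee_fin sqr_ge0. Qed.

Let measurable_h k : measurable_fun setT (h k).
Proof.
apply/measurable_EFinP; apply: measurable_funX; apply: measurable_funB => //.
exact: measurable_funM.
Qed.

(** The variance bound at [(k + 1) ^ 2] gives [2 * m] over [(k + 1) ^ 2]; the inverse square is at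
    most twice the telescoping difference, whence [4 * m]. *)
Let integral_h k :
  (\int[P]_w h k w <= ((4 * m)%:R * (k.+1%:R^-1 - k.+2%:R^-1))%:E)%E.
Proof.
set n := (k.+1 ^ 2)%N.
have n0 : 0 < n%:R :> R by rewrite ltr0n expn_gt0.
have hE w : h k w = ((n%:R ^-2)%:E * ((S n w - n%:R * p) ^+ 2)%:E)%E.
  by rewrite /h -/n -EFinM; congr EFin; field; rewrite gt_eqF.
under eq_integral do rewrite hE.
rewrite ge0_integralZl//; last 2 first.
- apply/measurable_EFinP; apply: measurable_funX.
  by apply: measurable_funB.
- by move=> w _; rewrite lee_fin sqr_ge0.
apply: (@le_trans _ _ ((n%:R ^-2)%:E * (n%:R * (2 * m)%:R)%:E)%E).
  by rewrite lee_pmul2l ?lte_fin ?invr_gt0 ?exprn_gt0//; exact: second_moment.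
rewrite -EFinM lee_fin mulrA natrM [(4 * m)%:R]natrM.
have k1 : 0 < k.+1%:R :> R by rewrite ltr0n.
have k2 : 0 < k.+2%:R :> R by rewrite ltr0n.
have -> : n%:R ^- 2 * n%:R = (k.+1%:R * k.+1%:R)^-1 :> R.
  rewrite expr2 invfM mulfVK ?gt_eqF//; congr (_^-1).
  by rewrite /n natrX expr2.
have -> : k.+1%:R^-1 - k.+2%:R^-1 = (k.+1%:R * k.+2%:R)^-1 :> R.
  move: k1 k2; rewrite -[k.+2%:R]natr1; move: (k.+1%:R : R) => x x1 x2.
  by field; rewrite !gt_eqF.
have key : (k.+1%:R * k.+1%:R)^-1 <= 2 * (k.+1%:R * k.+2%:R)^-1 :> R.
  rewrite !invfM mulrCA ler_wpM2l ?invr_ge0 ?(ltW k1)//.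
  rewrite -[X in X / _]invrK -invfM lef_pV2 ?posrE ?mulr_gt0 ?invr_gt0//.
  have : 1 <= k.+1%:R :> R by rewrite ler1n.
  by rewrite -[k.+2%:R]natr1; move: (k.+1%:R : R) => x x1; lra.
apply: le_trans (ler_wpM2r _ key) _; first by [].
by rewrite le_eqVlt; apply/orP; left; apply/eqP; ring.
Qed.

(* Along the squares the normalized second moments are summable; in between, the
   sums vary by at most the gap between consecutive squares. *)
Theorem strong_law :
  {ae P, forall w, (\sum_(i < n) \1_(E i) w) / n%:R @[n --> \oo] --> p}.
Proof.
have ifin : (\int[P]_w (\sum_(k <oo) h k w) < +oo)%E.
  rewrite integral_nneseries//;
    apply: (@le_lt_trans _ _ (4 * m)%:R%:E); last exact: ltry.
  apply: lime_le; first by apply: is_cvg_nneseries => k _ _; exact: integral_ge0.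
  apply: nearW => n; rewrite big_mkord.
  apply: (@le_trans _ _
    (\sum_(k < n) ((4 * m)%:R * (k.+1%:R^-1 - k.+2%:R^-1))%:E)%E).
    by apply: lee_sum => k _; exact: integral_h.
  rewrite sumEFin lee_fin -mulr_sumr ler_piMr//.
  rewrite -(big_mkord xpredT (fun k => k.+1%:R^-1 - k.+2%:R^-1)).
  under eq_bigr do rewrite -opprB.
  rewrite sumrN (telescope_sumr (fun k => k.+1%:R^-1))//= opprB lerBlDr invr1.
  by rewrite lerDl invr_ge0.
have mh : measurable_fun setT (fun w => \sum_(k <oo) h k w)%E.
  exact: ge0_emeasurable_sum.
have hs0 w : (0 <= \sum_(k <oo) h k w)%E by exact: nneseries_ge0.
have : P.-integrable setT (fun w => \sum_(k <oo) h k w)%E.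
  apply/integrableP; split=> //.
  by under eq_integral do rewrite gee0_abs//.
move=> /integrable_ae => /(_ measurableT).
apply: filterS => w /(_ I) hw.
apply: cvg_mean_squares.
  move=> n; rewrite /S big_ord_recr/= addrAC subrr add0r indicE.
  by case: (_ \in _); rewrite !lexx ler01.
(* Where the series is finite its tails tend to 0, and each term is bounded by the tail it
   starts. *)
have hcvg : (h ^~ w) @ \oo --> 0%E.
  have foo : (\sum_(0 <= k <oo) h k w < +oo)%E by rewrite ltey_eq hw.
  apply: (@squeeze_cvge _ _ _ _ (cst 0%E) _ (fun N => \sum_(N <= k <oo) h k w)%E).
  - apply: nearW => k; rewrite h0/=.
    rewrite (@nneseries_split _ _ k 1)// addn1 big_nat1 leeDl//.
    exact: nneseries_ge0.
  - exact: cvg_cst.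
  - exact: nneseries_tail_cvg.
have /fine_cvgP[_ hsq] := hcvg.
apply/cvgrPdist_lt => e e0.
have e20 : 0 < e ^+ 2 by rewrite exprn_gt0.
have [K _ HK] := (cvgrPdist_lt _ _).1 hsq _ e20.
exists K => // k /= Kk; have := HK k Kk.
rewrite /= sub0r normrN ger0_norm ?sqr_ge0// distrC.
by rewrite -[X in X < _ -> _]real_normK ?num_real// ltr_pXn2r// nnegrE ltW.
Qed.

End StrongLaw.

(** * Blocks of a random lower triangular matrix *)

Section RandomBlocks.
Context {R : realType} {F : finFieldType}.
Context {d : measure_display} {T : measurableType d}.
Variables (P : probability T R) (X : nat * nat -> T -> F).
Local Notation J := [set ij : nat * nat | (ij.2 <= ij.1)%N].
Hypothesis Xunif : forall ij, J ij -> uniform_rv P (X ij).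
Hypothesis Xindep : mutually_independent P J X.
Local Notation pr := (pr P).
Local Notation q := (#|F|%:R : R).

Let mX ij : J ij -> discrete_rv (X ij).
Proof. by move=> /Xunif[]. Qed.

Definition lower (x : nat * nat -> F) (i j : nat) : F :=
  if (j <= i)%N then x (i, j) else 0.

Lemma lower_trig x i j : (i < j)%N -> lower x i j = 0.
Proof. by rewrite /lower ltnNge => /negPf->. Qed.

Definition tri b t : {fset nat * nat} :=
  [fset ij in [seq (i, j) | i <- iota b t, j <- iota b t] | (ij.2 <= ij.1)%N]%fset.

Definition tri_row b t : {fset nat * nat} :=
  [fset ((b + t)%N, (b + nat_of_ord j)%N) | j in 'I_t.+1]%fset.

Lemma in_tri b t i j :
  ((i, j) \in tri b t) = [&& (b <= j)%N, (j <= i)%N & (i < b + t)%N].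
Proof.
rewrite !inE/= andbC; apply/andP/and3P => [[ji /allpairsP[[i' j'] /=]]|].
  rewrite !mem_iota => -[/andP[bi it] /andP[bj jt] [ei ej]].
  by rewrite ei ej in ji *.
move=> [bj ji it]; split=> //; apply/allpairsP; exists (i, j).
by rewrite /= !mem_iota; split=> //; lia.
Qed.

Lemma in_tri_row b t i j :
  ((i, j) \in tri_row b t) = [&& i == (b + t)%N, (b <= j)%N & (j <= b + t)%N].
Proof.
apply/imfsetP/and3P => /= [[k _ [-> ->]]|[/eqP-> bj jb]].
  by rewrite eqxx leq_addr leq_add2l -ltnS ltn_ord.
have jt : (j - b < t.+1)%N by lia.
by exists (Ordinal jt) => //=; rewrite subnKC.
Qed.

Lemma tri_sub b t : [set` tri b t] `<=` J.
Proof. by move=> [i j] /=; rewrite in_tri => /and3P[]. Qed.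

Lemma tri_row_sub b t : [set` tri_row b t] `<=` J.
Proof. by move=> [i j] /=; rewrite in_tri_row => /and3P[/eqP->]. Qed.

Lemma block_dep b t (f : 'M[F]_(t, t.+1) -> bool) :
  depends_on (tri b t) (fun x => f (block (lower x) b t)).
Proof.
move=> x y xy; congr f; apply/matrixP => i j; rewrite !mxE /lower leq_add2l.
case: leqP => // ji; apply: xy.
by rewrite in_tri leq_addr leq_add2l ji ltn_add2l ltn_ord.
Qed.

Lemma block_row_dep b t (f : 'rV[F]_t.+1 -> bool) :
  depends_on (tri_row b t) (fun x => f (block_row (lower x) b t)).
Proof.
move=> x y xy; congr f; apply/rowP => j; rewrite !mxE /lower leq_add2l.
case: leqP => // ji; apply: xy.
by rewrite in_tri_row eqxx leq_addr leq_add2l.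
Qed.

(** All [t + 1] entries of the new row lie on or below the diagonal, so they are independent and
    uniform. *)
Lemma pr_block_row_eq b t (r : 'rV[F]_t.+1) :
  pr (event X (fun x => block_row (lower x) b t == r)) = q ^- t.+1.
Proof.
pose a (ij : nat * nat) : F := r 0 (inord (ij.2 - b)).
have -> : event X (fun x => block_row (lower x) b t == r) = cyl X (tri_row b t) a.
  apply/seteqP; split=> [w /eqP rw [i j]|w wr].
    rewrite in_tri_row => /and3P[/eqP-> bj jb].
    by rewrite /a -rw mxE /lower/= inordK ?subnKC ?jb//; lia.
  apply/eqP/rowP => j; rewrite mxE /lower leq_add2l -ltnS ltn_ord wr /a/=.
    by rewrite addKn inord_val.
  by rewrite in_tri_row eqxx leq_addr leq_add2l -ltnS ltn_ord.
rewrite (pr_cyl mX Xindep); last exact: tri_row_sub.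
rewrite big_imfset/=; last by move=> i j _ _ [/addnI/val_inj].
rewrite (eq_bigr (fun=> q^-1)); last first.
  move=> j _; have /Xunif[_] : J ((b + t)%N, (b + j)%N).
    by rewrite /= leq_add2l -ltnS.
  by move=> /(_ (a ((b + t)%N, (b + j)%N)))/pr_EFin.
by rewrite big_enum/= prodr_const card_ord exprVn.
Qed.

Lemma pr_block_row b t (f : pred 'rV[F]_t.+1) :
  pr (event X (fun x => f (block_row (lower x) b t))) =
  #|[set r | f r]%SET|%:R / q ^+ t.+1.
Proof.
have mE g : measurable (event X (fun x => g (block_row (lower x) b t))).
  exact: (measurable_event mX 0 (@tri_row_sub b t) (@block_row_dep b t g)).
rewrite (@pr_total _ _ _ P _ (fun w => block_row (lower (X ^~ w)) b t)
   (index_enum _)) ?index_enum_uniq//; last 2 first.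
- by move=> r _; rewrite (event_eq X (fun x => block_row (lower x) b t));
    exact: (mE (pred1 r)).
- by move=> w _; rewrite mem_index_enum.
transitivity (\sum_(r | f r) q ^- t.+1).
  rewrite [RHS]big_mkcond; apply: eq_bigr => r _; case: ifPn => fr.
    rewrite -(pr_block_row_eq b r); congr pr; apply/seteqP; split=> [w [_ wr]|w].
      exact/eqP.
    by rewrite /event/= => /eqP wr; split=> //=; rewrite wr.
  rewrite (_ : _ `&` _ = set0) ?pr0//; apply/seteqP; split=> // w [/= h wr].
  by move: h; rewrite /event/= wr (negPf fr).
rewrite sumr_const mulr_natl; congr (_ *+ _).
by apply: eq_card => r; rewrite inE.
Qed.

Let measurable_block b t (f : pred 'M[F]_(t, t.+1)) :
  measurable (event X (fun x => f (block (lower x) b t))).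
Proof. exact: (measurable_event mX 0 (@tri_sub b t) (@block_dep b t f)). Qed.

Lemma disjoint_tri_row b t : [disjoint tri b t & tri_row b t]%fset.
Proof.
apply/fdisjointP => -[i j]; rewrite in_tri in_tri_row => /and3P[_ _ it].
by rewrite (ltn_eqF it).
Qed.

Lemma block_step_dep b t (f : 'M[F]_(t, t.+1) -> 'rV[F]_t.+1 -> bool) :
  depends_on (tri b t.+1)
    (fun x => f (block (lower x) b t) (block_row (lower x) b t)).
Proof.
move=> x y xy; congr f.
  apply/matrixP => i j; rewrite !mxE /lower leq_add2l; case: leqP => // ji.
  apply: xy; rewrite in_tri leq_addr leq_add2l ji ltn_add2l.
  exact: leq_trans (ltn_ord i) (leqnSn t).
apply/rowP => j; rewrite !mxE /lower leq_add2l.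
case: leqP => // ji; apply: xy.
by rewrite in_tri leq_addr leq_add2l ji ltn_add2l /=.
Qed.

Let measurable_block_step b t (f : 'M[F]_(t, t.+1) -> 'rV[F]_t.+1 -> bool) :
  measurable (event X (fun x => f (block (lower x) b t) (block_row (lower x) b t))).
Proof. exact: (measurable_event mX 0 (@tri_sub b t.+1) (@block_step_dep b t f)). Qed.

(** Conditioning on the block: its entries are disjoint from those of the next row, which stays
    uniform. Probabilities of one step thus reduce to counting rows. *)
Lemma pr_block_step b t (f : 'M[F]_(t, t.+1) -> 'rV[F]_t.+1 -> bool) :
  pr (event X (fun x => f (block (lower x) b t) (block_row (lower x) b t))) =
  \sum_B pr (event X (fun x => block (lower x) b t == B)) *
    (#|[set r | f B r]%SET|%:R / q ^+ t.+1).
Proof.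
rewrite (@pr_total _ _ _ P _ (fun w => block (lower (X ^~ w)) b t)
   (index_enum _)) ?index_enum_uniq//; last 2 first.
- move=> B _; rewrite (event_eq X (fun x => block (lower x) b t)).
  exact: (@measurable_block b t (pred1 B)).
- by move=> w _; rewrite mem_index_enum.
apply: eq_bigr => B _; rewrite -(pr_block_row b).
rewrite -(pr_eventI mX Xindep 0 (@tri_sub b t) (@tri_row_sub b t)
  (disjoint_tri_row b t) (@block_dep b t (pred1 B)) (@block_row_dep b t (f B))).
congr pr; apply/seteqP; split=> w; rewrite /event/=.
  by move=> [+ wB]; rewrite wB; split.
by move=> [/eqP wB]; rewrite wB.
Qed.

Lemma pr_block b t (f : pred 'M[F]_(t, t.+1)) :
  pr (event X (fun x => f (block (lower x) b t))) =
  \sum_B pr (event X (fun x => block (lower x) b t == B)) * (f B)%:R.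
Proof.
have q0 : q != 0 by rewrite pnatr_eq0 -lt0n card_field_gt0.
rewrite (pr_block_step b (fun B _ => f B)); apply: eq_bigr => B _; congr (_ * _).
case: (f B); last by rewrite (eq_card0 _) ?mul0r// => r; rewrite inE.
rewrite (eq_card (_ : _ =i predT)) => [|r]; last by rewrite inE.
by rewrite card_rV natrX divff ?expf_neq0.
Qed.

(** Averaging [alive_step] over the block yields the recursion of [profile]. The block without rows
    has rank 0 and does not span [e0], so it starts with [j = 0]. *)
Lemma pr_alive b t j :
  pr (event X (fun x => alive t j (block (lower x) b t))) = profile q t j.
Proof.
elim: t j => [|t IH] j.
  rewrite /=; have [->|j0] := eqVneq j 0%N.
    rewrite (_ : event _ _ = setT) ?prT//; apply/seteqP; split=> // w _.
    rewrite /event/= /alive; set B := block _ _ _.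
    rewrite (_ : B = 0); last by apply/matrixP => -[].
    rewrite mxrank0 eqxx andbT; apply/negP => /submxP[D]; rewrite mulmx0.
    move=> /rowP/(_ 0).
    by rewrite !mxE !eqxx => /eqP; rewrite oner_eq0.
  rewrite (_ : event _ _ = set0) ?pr0//; apply/seteqP; split=> // w.
  by rewrite /event/= /alive addn_eq0 (negPf j0) !andbF.
have -> : event X (fun x => alive t.+1 j (block (lower x) b t.+1)) =
    event X (fun x => alive t.+1 j
      (col_mx (block (lower x) b t) (block_row (lower x) b t))).
  apply/funext => w; rewrite /event/= /alive e0_blockS ?rank_blockS//;
  exact: lower_trig.
rewrite (pr_block_step b (fun B r => alive t.+1 j (col_mx B r))).
under eq_bigr do rewrite alive_step mulrDr !mulrA.
rewrite big_split/= -!mulr_suml -pr_block IH; congr (_ + _).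
rewrite mulrA; congr (_ * _).
case: j => [|j] /=; last by rewrite mul1r -IH pr_block.
by rewrite mul0r big1// => B _; rewrite mulr0.
Qed.

(** By [diagram_block], death at age [k] of the class born at time [b + 1], phrased through finitely
    many entries so that independence applies. *)
Definition dies b k (x : nat * nat -> F) : bool :=
  (e0 <= block (lower x) b k.+1)%MS && ~~ (e0 <= block (lower x) b k)%MS.

Lemma diesE b k : dies b k = (fun x => (e0 <= col_mx (block (lower x) b k)
  (block_row (lower x) b k))%MS && ~~ (e0 <= block (lower x) b k)%MS).
Proof. by apply/funext => x; rewrite /dies e0_blockS//; exact: lower_trig. Qed.

Lemma dies_dep b k : depends_on (tri b k.+1) (dies b k).
Proof.
by rewrite diesE; exact: (@block_step_dep b k
  (fun B r => (e0 <= col_mx B r)%MS && ~~ (e0 <= B)%MS)).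
Qed.

Lemma measurable_dies b k : measurable (event X (dies b k)).
Proof. exact: (measurable_event mX 0 (@tri_sub b k.+1) (@dies_dep b k)). Qed.

Lemma pr_dies b k : pr (event X (dies b k)) =
  \sum_(j < k.+1) profile q k j * (q ^- j * (1 - q^-1)).
Proof.
rewrite diesE (pr_block_step b
  (fun B r => (e0 <= col_mx B r)%MS && ~~ (e0 <= B)%MS)).
under [RHS]eq_bigr do rewrite -(pr_alive b) pr_block mulr_suml.
rewrite exchange_big/=; apply: eq_bigr => B _.
under [RHS]eq_bigr do rewrite -mulrA.
rewrite -mulr_sumr; congr (_ * _).
have [eB|eB] := boolP (e0 <= B)%MS.
  rewrite big1 => [|j _]; last by rewrite /alive eB mul0r.
  by rewrite (eq_card0 _) ?mul0r// => r; rewrite inE andbF.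
under eq_finset do rewrite andbT.
rewrite death_step//.
have rB := rank_leq_row B.
have jB : (k - \rank B < k.+1)%N by rewrite ltnS leq_subr.
(* A given block has exactly one number of live classes, [k - \rank B], so one term survives. *)
rewrite (bigD1 (Ordinal jB))//= big1 ?addr0 => [|j].
  by rewrite /alive eB subnKC// eqxx mul1r.
rewrite -val_eqE/= => jk; rewrite /alive (_ : (_ == k) = false) ?andbF ?mul0r//.
by apply/negbTE; apply: contra jk => /eqP e; apply/eqP; lia.
Qed.

(** The two triangles of entries have no row in common. *)
Lemma pr_diesI b b' k : (b + k.+1 <= b')%N ->
  pr (event X (dies b k) `&` event X (dies b' k)) =
  pr (event X (dies b k)) * pr (event X (dies b' k)).
Proof.
move=> bb'; apply: (pr_eventI mX Xindep 0 (@tri_sub b k.+1) (@tri_sub b' k.+1)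
  _ (@dies_dep b k) (@dies_dep b' k)).
apply/fdisjointP => -[i j]; rewrite !in_tri => /and3P[_ _ ib].
by apply/negP => /and3P[]; lia.
Qed.

End RandomBlocks.

(** * From death events to the empirical frequencies *)

Section DiagramCount.

Lemma card_diagram (F : fieldType) (M : nat -> nat -> F) n k :
  (forall i j, (i < j)%N -> M i j = 0) ->
  #|` fset_set [set p | (diagram M `&` `[1%N, n] `*` `[1%N, n]) p /\
                        (p.2 - p.1)%N = k]| =
  (\sum_(b < n - k) `[< diagram M (b.+1, (b.+1 + k)%N) >])%N.
Proof.
move=> trig.
pose s := [seq b <- iota 0 (n - k) | `[< diagram M (b.+1, (b.+1 + k)%N) >]].
pose t := [seq (b.+1, (b.+1 + k)%N) | b <- s].
have ut : uniq t by rewrite map_inj_uniq ?filter_uniq ?iota_uniq// => i j [].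
rewrite (_ : [set p | _] = [set` [fset p in t]%fset]).
  rewrite set_fsetK (perm_size (uniq_perm (fset_uniq _) ut _)) => [|p].
    rewrite size_map size_filter -sum1_count big_mkcond/=.
    by rewrite -{1}[(n - k)%N]subn0 -/(index_iota _ _) big_mkord.
  by rewrite inE.
apply/seteqP; split=> [[b e] [[De []]]|p] /=; rewrite inE/=.
  rewrite !in_itv/= => /andP[b1 _] /andP[_ en] ek.
  (* A death never precedes the birth, so the truncated difference [e - b] is the true one. *)
  have be : (b <= e)%N.
    by have [_ [/(reach_gt trig)]] := De; rewrite /= prednK.
  have eE : e = (b.-1.+1 + k)%N by rewrite prednK// -ek subnKC.
  have bE : b = b.-1.+1 by rewrite prednK.
  rewrite inE; apply/mapP; exists b.-1; last by rewrite -bE {1}eE -bE.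
  rewrite mem_filter mem_iota /= add0n -eE -bE; apply/andP; split.
    exact/asboolP.
  move: en; rewrite /Order.le/= => en; lia.
move=> /mapP[b]; rewrite mem_filter mem_iota /= add0n => /andP[/asboolP Db bn] ->.
split=> /=; last by rewrite addKn.
by split=> //; split; rewrite /= in_itv/= /Order.le/=; lia.
Qed.

(** A class of lifetime [k] fits into the window only if born by [n - k], while the count is divided
    by [n]; the ratio of the two tends to 1. *)
Lemma cvg_shift_mean (R : realType) (S : nat -> R) (p : R) k :
  S 0 = 0 -> S n / n%:R @[n --> \oo] --> p ->
  S (n - k)%N / n%:R @[n --> \oo] --> p.
Proof.
move=> S0 Sp; rewrite -(cvg_shiftn k).
rewrite [X in X @ _ --> _](_ : _ = fun n => S n / n%:R * (1 - k%:R * (n + k)%:R^-1)).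
  suff : S n / n%:R * (1 - k%:R * (n + k)%:R^-1) @[n --> \oo] --> p * (1 - k%:R * 0).
    by rewrite mulr0 subr0 mulr1.
  apply: cvgM => //; apply: cvgB; first exact: cvg_cst.
  apply: cvgMr.
  rewrite (cvg_shiftn k (fun n => n%:R^-1 : R)) -cvg_shiftS.
  exact: cvg_harmonic.
apply/funext => n /=; rewrite addnK; have [->|n0] := posnP n.
  by rewrite S0 !mul0r.
have n0' : n%:R != 0 :> R by rewrite pnatr_eq0 -lt0n.
have nk0 : (n + k)%:R != 0 :> R by rewrite pnatr_eq0 addn_eq0 negb_and -lt0n n0.
by rewrite natrD in nk0 *; field; rewrite n0' nk0.
Qed.
End DiagramCount.


Theorem theorem3 (R : realType) (F : finFieldType)
  (d : measure_display) (T : measurableType d) (P : probability T R)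
  (L : nat -> nat -> T -> F)
  (Lunif : forall i j : nat, (j <= i)%N -> uniform_rv P (L i j))
  (Lindep : mutually_independent P [set ij : nat * nat | (ij.2 <= ij.1)%N]
     (fun ij => L ij.1 ij.2))
  (Ltrig : forall i j : nat, (i < j)%N -> forall w : T, L i j w = 0)
  (d' : measure_display) (T' : measurableType d') (P' : probability T' R)
  (G : T' -> nat) (Y : nat -> T' -> nat)
  (Ggeom : shifted_geometric P' ((#|F|%:R - 1) / #|F|%:R) G)
  (Ygeom : forall i : nat, (1 <= i)%N ->
     shifted_geometric P' ((#|F|%:R : R) ^- i) (Y i))
  (GYindep : mutually_independent P' [set: nat]
     (fun i => if i is 0%N then G else Y i)) :
  let X : T' -> nat := fun w => (\sum_(1 <= i < G w) Y i w)%N in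
  {ae P, forall w : T,
    exists D : set (nat * nat),
      [/\ is_verbose_diagram (fun i j => L i j w) D,
          forall D', is_verbose_diagram (fun i j => L i j w) D' -> D' = D &
          forall k : nat,
            (#|` fset_set [set p | (D `&` `[1%N, n] `*` `[1%N, n]) p /\
                                   (p.2 - p.1)%N = k]|%:R / n%:R : R)
              @[n --> \oo] --> fine (P' (X @^-1` [set k]))]}.
Proof.
move=> X.
pose XL (ij : nat * nat) w := L ij.1 ij.2 w.
have Lw w : (fun i j => L i j w) = lower (XL ^~ w).
  apply/funext => i; apply/funext => j; rewrite /lower /XL/=.
  by case: leqP => // ij; exact: Ltrig.
have Xunif ij : [set ij : nat * nat | (ij.2 <= ij.1)%N] ij -> uniform_rv P (XL ij).
  exact: Lunif.
have q0 : (#|F|%:R : R) != 0 by rewrite pnatr_eq0 -lt0n card_field_gt0.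
pose p k := pr P' (X @^-1` [set k]).
have prd b k : pr P (event XL (dies b k)) = p k.
  rewrite (pr_dies Xunif Lindep) /p.
  by rewrite (pr_geometric_sum q0 Ggeom Ygeom GYindep).
have diesP b k w : event XL (dies b k) w <->
    diagram (fun i j => L i j w) (b.+1, (b.+1 + k)%N).
  rewrite diagram_block; last by move=> i j ij; exact: Ltrig.
  by rewrite Lw.
have mdies b k : measurable (event XL (dies b k)) by exact: measurable_dies Xunif b k.
have mean k : {ae P, forall w,
    (\sum_(i < n) \1_(event XL (dies i k)) w) / n%:R @[n --> \oo] --> p k}.
  (* The gap [k.+1] is the number of rows of the block deciding death at age [k]. *)
  apply: (@strong_law _ _ _ P (fun b => event XL (dies b k)) (p k) k.+1) => //.
  by move=> i j ij; rewrite (pr_diesI Xunif Lindep ij) !prd expr2.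
have mortal b : {ae P, forall w, exists k, event XL (dies b k) w}.
  pose U := \bigcup_k event XL (dies b k).
  have mU : measurable U by exact: bigcup_measurable.
  have tU : trivIset setT (fun k => event XL (dies b k)).
    move=> k l _ _ [w [/diesP [_ [/= rk lk]] /diesP [_ [/= rl ll]]]].
    by have := lk _ rl; have := ll _ rk; rewrite !leq_add2l => lk' kl; lia.
  (* The [dies b k] are disjoint in [k] and their probabilities add up to 1 since
     [X] takes finite values. *)
  have prU : pr P U = 1.
    have c1 := @cvg_pr_bigcup _ _ _ P _ (mdies b) tU.
    have c2 := pr_nat_total P' (measurable_geometric_sum Ggeom Ygeom).
    rewrite -(cvg_lim (@Rhausdorff R) c1) -(cvg_lim (@Rhausdorff R) c2).
    by congr (limn _); apply/funext => n; apply: eq_bigr => k _; exact: prd.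
  exists (~` U); split; first exact: measurableC.
  - by rewrite probability_setC// prE// prU subee.
  - by move=> w /= nw [k _ Uk]; apply: nw; exists k.
(* Countably many null sets, over all ages and all births, are discarded at once; the rest holds for
   each remaining [w]. *)
apply: (filterS2 _ _ (ae_foralln mean) (ae_foralln mortal)) => w meanw mortalw.
have trig i j : (i < j)%N -> L i j w = 0 by move=> ij; exact: Ltrig.
exists (diagram (fun i j => L i j w)); split.
- apply: diagram_verbose => // b; have [k /diesP [_ [/= rk _]]] := mortalw b.
  by exists (b.+1 + k)%N.
- exact: verbose_diagram_unique.
- move=> k; have := meanw k; move=> /(@cvg_shift_mean _ _ _ k).
  rewrite big_ord0 => /(_ erefl); apply: cvg_trans; apply: near_eq_cvg.
  apply: nearW => n; rewrite card_diagram// natr_sum; congr (_ / _).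
  apply: eq_bigr => b _; rewrite indicE; congr (_%:R).
  congr nat_of_bool; apply/idP/idP => [/set_mem/diesP/asboolP//|].
  by move=> /asboolP/diesP/mem_set.
Qed.
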